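(* Let $N\ge 2$ be an integer and let $\pi$ be a permutation of $\{1,\ldots,N\}$. Let $V_\pi$ be the operator on copulas induced by the transformation matrix $T_\pi$, let $A_\pi^*$ be its unique fixed point, and let $M(x,y)=\min\{x,y\}$. Then the copula $A_\pi^*$ satisfies \begin{align*} \tau(A_\pi^* ) &= 1-4\,\frac{N}{N-1}\,\lambda_2\bigl(\Omega_{\sqrt2}^{V_\pi(M)}\bigr)\\ &= 1-4\,\frac{1}{N(N-1)}\,\#\bigl\{(i,j)\in\{1,\ldots,N\}^2:\ \pi(i)<j \text{ and } \pi^{-1}(j)<i\bigr\},\\ \ell(A_\pi^* ) &= 1-(2-\sqrt2)\,\frac{N}{N-1}\,\lambda_2\bigl(\Omega_{\sqrt2}^{V_\pi(M)}\bigr)\\ &= 1-(2-\sqrt2)\,\frac{1}{N(N-1)}\,\#\bigl\{(i,j)\in\{1,\ldots,N\}^2:\ \pi(i)<j \text{ and } \pi^{-1}(j)<i\bigr\},\\ \mathrm{surf}(A_\pi^* ) &= \sqrt2-\bigl(2\sqrt2-1-\sqrt3\bigr)\,\frac{N}{N-1}\,\lambda_2\bigl(\Omega_{\sqrt2}^{V_\pi(M)}\bigr). \end{align*}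
   Context: $\lambda$ and $\lambda_2$ denote Lebesgue measure on the Borel sets of $[0,1]$ and $[0,1]^2$. For a bivariate copula $A$, $\mu_A$ denotes the corresponding doubly stochastic probability measure on $[0,1]^2$, i.e. $\mu_A([0,x]\times[0,y])=A(x,y)$ for all $x,y\in[0,1]$; copulas and doubly stochastic measures are identified in this way. $\mu^w$ denotes the push-forward of $\mu$ under $w$, and $\#S$ is the cardinality of $S$. Operator $V_\pi$: the transformation matrix of $\pi$ is $T_\pi=(t_{ij})_{i,j=1}^N$ with $t_{ij}=\frac1N$ if $\pi(i)=j$ and $t_{ij}=0$ otherwise. All row and column sums equal $\frac1N$. For $i,j\in\{1,\ldots,N\}$ let $w_{ji}:[0,1]^2\to[\frac{j-1}{N},\frac jN]\times[\frac{i-1}{N},\frac iN]$ be $w_{ji}(x,y)=\bigl(\frac{j-1+x}{N},\frac{i-1+y}{N}\bigr)$. Then $V_\pi(\mu)=\sum_{j=1}^N\sum_{i=1}^N t_{ij}\,\mu^{w_{ji}}$, which maps doubly stochastic measures to doubly stochastic measures, hence copulas to copulas. There is a unique copula $A_\pi^*$ with $V_\pi(A_\pi^* )=A_\pi^*$ (known from earlier work). Mutually completely dependent copulas: for a (Borel measurable) bijection $h:[0,1]\to[0,1]$ that is $\lambda$-preserving (i.e. $\lambda(h^{-1}(E))=\lambda(E)$ for every Borel set $E\subseteq[0,1]$), $A_h$ is the copula $A_h(x,y)=\lambda\{t\in[0,x]: h(t)\le y\}$; copulas of this form are called mutually completely dependent. $V_\pi$ maps this class to itself, $M$ (given by $h=\mathrm{id}$)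 belongs to it, and so does $A_\pi^*$. For such a copula, $$\Omega_{\sqrt2}^{A_h}=\{(x,y)\in(0,1)^2:\ h(x)\le y,\ h^{-1}(y)\le x\},$$ which up to a $\lambda_2$-null set depends only on the copula $A_h$. Kendall's tau: $\tau(A)=4\int_{[0,1]^2}A\,d\mu_A-1$. Length measure: for a copula $A$ and $t\in[0,1]$ let $[A]_t=\{(x,y)\in[0,1]^2: A(x,y)\ge t\}$, let $\Gamma_{A,t}$ be the boundary of $[A]_t$ in $(0,1)^2$, and let $L_A(t)=H_1(\Gamma_{A,t})$ be its arc-length ($H_1$ is one-dimensional Hausdorff measure); then $\ell(A)=\int_{(0,1)}L_A(t)\,d\lambda(t)$. Surface area: $\mathrm{surf}(A)=\int_{[0,1]^2}\sqrt{(\partial A/\partial x)^2+(\partial A/\partial y)^2+1}\;d\lambda_2$ (copulas are Lipschitz, so the partial derivatives exist $\lambda_2$-almost everywhere). *)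

(* Defs.v *)
From mathcomp Require Import all_boot all_order all_algebra all_fingroup.
From mathcomp Require Import all_classical all_reals all_analysis.

Set Implicit Arguments.
Unset Strict Implicit.
Unset Printing Implicit Defensive.

Import Order.TTheory GRing.Theory Num.Theory.
Import numFieldNormedType.Exports.

Local Open Scope classical_set_scope.
Local Open Scope ring_scope.

Section copulas.
Context {R : realType}.
Implicit Types (x y t : R) (h : R -> R) (E : set R).

Definition leb : set R -> \bar R := @lebesgue_measure R.

Definition leb2 :
    {measure set (measurableTypeR R * measurableTypeR R) -> \bar R} :=
  (@lebesgue_measure R \x @lebesgue_measure R)%E.

Definition I01 : set R := `[0, 1].

Definition square : set (R * R) := I01 `*` I01.

Definition open_square : set (R * R) := `]0, 1[ `*` `]0, 1[.

(* The first clause with E = [0, 1] gives mu full mass on [0, 1]^2, so mu is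
   just a measure on [0, 1]^2 viewed in R^2. *)
Definition doubly_stochastic (mu : set (R * R) -> \bar R) : Prop :=
  forall E, measurable E -> E `<=` I01 ->
    mu (E `*` I01) = leb E /\ mu (I01 `*` E) = leb E.

Definition joint_cdf (mu : set (R * R) -> \bar R) x y : R :=
  fine (mu (`[0, x] `*` `[0, y])).

(* A copula is identified with its doubly stochastic measure; only the values
   of the function copula_fun A on [0, 1]^2 are meaningful. *)
Record copula := Copula {
  copula_measure : probability (measurableTypeR R * measurableTypeR R)%type R ;
  copula_measureP : doubly_stochastic copula_measure }.

Definition copula_fun (A : copula) : R -> R -> R := joint_cdf (copula_measure A).

Coercion copula_fun : copula >-> Funclass.

Definition eq_on_square (F G : R -> R -> R) : Prop :=
  forall x y, I01 x -> I01 y -> F x y = G x y.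

(* Indices are 0-based: i : 'I_N stands for i + 1 in {1, ..., N}. *)
Definition transformation_mx N (pi : 'S_N) : 'M[R]_N :=
  \matrix_(i, j) (if pi i == j then N%:R^-1 else 0).

Definition cell_map N (j i : 'I_N) (p : R * R) : R * R :=
  ((j%:R + p.1) / N%:R, (i%:R + p.2) / N%:R).

Definition Vop N (pi : 'S_N) (mu : set (R * R) -> \bar R) :
    set (R * R) -> \bar R :=
  fun S => (\sum_(j < N) \sum_(i < N)
    (transformation_mx pi i j)%:E * pushforward mu (cell_map j i) S)%E.

Definition measure_preserving_bij h : Prop :=
  [/\ set_bij I01 I01 h, measurable_fun I01 h &
      forall E, measurable E -> E `<=` I01 -> leb (I01 `&` h @^-1` E) = leb E].

Definition mcd_fun h x y : R := fine (leb [set t | 0 <= t <= x /\ h t <= y]).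

Definition Omega_sqrt2 h : set (R * R) :=
  [set p | [/\ open_square p, h p.1 <= p.2 &
               'pinv_(fun=> 0) I01 h p.2 <= p.1]].

Definition kendall_tau (A : copula) : \bar R :=
  (4%:E * (\int[copula_measure A]_(p in square) (A p.1 p.2)%:E) - 1)%E.

(* The product type R * R carries the sup norm, hence an explicit Euclidean
   distance for the Hausdorff measure. *)
Definition euclid_dist (p q : R * R) : R :=
  Num.sqrt ((p.1 - q.1) ^+ 2 + (p.2 - q.2) ^+ 2).

Definition euclid_diam (U : set (R * R)) : \bar R :=
  ereal_sup (0%E |` [set (euclid_dist p q)%:E | p in U & q in U]).

Definition hausdorff1_pre (d : R) (S : set (R * R)) : \bar R :=
  ereal_inf [set (\sum_(0 <= k <oo) euclid_diam (F k))%E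
    | F in [set F : (set (R * R))^nat |
        S `<=` \bigcup_k F k /\ forall k, (euclid_diam (F k) <= d%:E)%E]].

Definition hausdorff1 (S : set (R * R)) : \bar R :=
  ereal_sup [set hausdorff1_pre d S | d in [set d : R | 0 < d]].

Definition upper_set (A : copula) t : set (R * R) :=
  [set p | square p /\ t <= A p.1 p.2].

(* (0, 1)^2 is open, so the boundary relative to it is the trace of the
   boundary in R^2. *)
Definition level_boundary (A : copula) t : set (R * R) :=
  (closure (upper_set A t) `\` interior (upper_set A t)) `&` open_square.

Definition length_measure (A : copula) : \bar R :=
  (\int[lebesgue_measure]_(t in `]0%R, 1%R[) hausdorff1 (level_boundary A t))%E.

Definition surf (A : copula) : \bar R :=
  (\int[leb2]_(p in square)
    (Num.sqrt (derive1 (fun s => A s p.2) p.1 ^+ 2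
             + derive1 (fun s => A p.1 s) p.2 ^+ 2 + 1))%:E)%E.

Definition dominated_pairs N (pi : 'S_N) : {set 'I_N * 'I_N} :=
  [set p : 'I_N * 'I_N | (pi p.1 < p.2)%N && ((pi^-1)%g p.2 < p.1)%N].

End copulas.

Arguments copula R : clear implicits.

(* Main.v *)
(* The equation V_pi(A) = A says how A looks on the N^2 cells of the uniform
   grid: A is a rescaled copy of itself plus a constant on the N cells lying
   over the graph of pi, and of the form (c + a x + b y) / N with a, b in {0, 1}
   on all others.  Hence each of the three functionals satisfies an affine
   equation m = C + m / N, solved by m = C N / (N - 1), where C is obtained by
   counting cells according to (a, b): the cells with a = b = 1 are the
   dominated pairs, and the involution (j, k) |-> (pi k, pi^-1 j) shows that
   those with a = b = 0 are equally many.

   For Kendall's tau, the equation is obtained by integrating A against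
   mu_A = V_pi(mu_A).  For the surface and the length, the integrand is not
   known to be measurable; it is squeezed between iterates, started at 0 and at
   an upper bound, of the operator on functions that encodes self-similarity,
   and the integrals of both iterates converge to C N / (N - 1).  In the case of
   the length, the level curve at t that is not an N-adic number consists of
   segments in the cells off the graph of pi, of rescaled level curves in the
   cells over it, and of finitely many points on the grid lines.

   Finally, if A_h = V_pi(M), then h is almost everywhere the piecewise
   translation sending the j-th column to the row pi^-1(j), so that Omega is a
   union of dominated cells up to a null set. *)

From HB Require Import structures.
Require Import Defs.
From mathcomp Require Import all_boot all_order all_algebra all_fingroup.
From mathcomp Require Import all_classical all_reals all_analysis.
From mathcomp Require Import measurable_realfun ring lra.

Set Implicit Arguments.
Unset Strict Implicit.
Unset Printing Implicit Defensive.

Import Order.TTheory GRing.Theory Num.Theory.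
Import numFieldNormedType.Exports.

Local Open Scope classical_set_scope.
Local Open Scope ring_scope.

(** * Integrals and affine maps *)

(** Solving m = C + m / N presupposes that m is finite, and deriving it requires that integrals add
    up; for the length neither is available at the outset. The upper bound therefore works with
    [hausdorff1_pre d] at a fixed scale d. Once N^n d is at least sqrt 2, the rescaled curves left
    after n subdivisions have diameter at most d and may be covered by themselves. As m |-> C + m /
    N is a contraction, the upper and the lower starting value lead to the same limit. For the lower
    bound the obstacle is that a covering set may meet several cells, so each piece is first cut
    away from the boundary of its cell.

    The factor 1/N arises as N cells times N^-2: value and mass for tau, length and level for the
    length, area for the surface. A cell with both, one or no slope equal to 1 has weight sqrt 2, 1,
    0 for the length and sqrt 3, sqrt 2, 1 for the surface; the first and the last kind being
    equally many, only w11 + w00 - 2 w10 enters, which gives sqrt 2 - 2 and sqrt 3 + 1 - 2 sqrt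
    2. *)

Section integral_tools.
Context {R : realType}.
Local Open Scope ereal_scope.
Import HBNNSimple.

(* No measurability of [f] or [g] is assumed: the integral of a nonnegative
   function is a supremum over the simple functions below it. *)
Lemma ge0_le_integral_negl d (T : measurableType d)
    (mu : {measure set T -> \bar R}) (D Z : set T) (f g : T -> \bar R) :
  measurable Z -> mu Z = 0 ->
  (forall x, D x -> 0 <= f x) -> (forall x, D x -> 0 <= g x) ->
  (forall x, D x -> ~ Z x -> f x <= g x) ->
  \int[mu]_(x in D) f x <= \int[mu]_(x in D) g x.
Proof.
move=> mZ Z0 f0 g0 fg; rewrite !ge0_integralE//=.
apply: ge_ereal_sup => _ [h /= hf <-].
(* Cutting the simple function [h] off on [Z] leaves its integral unchanged and puts it below [g] on
   all of [D]. *)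
pose h' := proj_nnsfun h (measurableC mZ).
apply: le_ereal_sup_tmp; exists (sintegral mu h').
  exists h' => //= x; rewrite /mindic indicE.
  have [xZ|xZ] := boolP (x \in ~` Z); last first.
    by rewrite mulr0 erestrict_ge0.
  rewrite mulr1; apply: le_trans (hf x) _; rewrite !patchE; case: ifPn => //.
  by rewrite inE => Dx; apply: fg => //; move: xZ; rewrite inE.
rewrite -!integralT_nnsfun (ge0_negligible_integral _ _ _ _ Z0)//=; last 2 first.
- exact/measurable_EFinP.
- by move=> x _; rewrite lee_fin.
rewrite [leRHS](ge0_negligible_integral mZ _ _ _ Z0)//=; last 2 first.
- by apply/measurable_EFinP; exact: measurable_funM.
- by move=> x _; rewrite lee_fin mulr_ge0.
rewrite le_eqVlt; apply/orP; left; apply/eqP; apply: eq_integral => x.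
by rewrite inE/= => -[_ Zx]; rewrite /mindic indicE mem_set ?mulr1.
Qed.

Lemma measurable_affine (a b : R) :
  measurable_fun setT
    ((fun x => a * x + b)%R : measurableTypeR R -> measurableTypeR R).
Proof. by apply: measurable_funD => //; exact: measurable_funM. Qed.

(** [a] times the push-forward agrees with Lebesgue measure on half-open intervals, which determine
    it. *)
Lemma lebesgue_measure_affine (a b : R) (A : set R) : (0 < a)%R ->
  measurable A ->
  pushforward (@lebesgue_measure R)
    ((fun x => a * x + b)%R : _ -> measurableTypeR R) A
  = (a^-1)%:E * lebesgue_measure A.
Proof.
move=> a0 mA.
have an0 : a != 0%R by rewrite gt_eqF.
pose f : measurableTypeR R -> measurableTypeR R := (fun x => a * x + b)%R.
have mf : measurable_fun setT f by exact: measurable_affine.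
have a0' : (0 <= a)%R by exact: ltW.
pose m' : {measure set (measurableTypeR R) -> \bar R} :=
  mscale (NngNum a0') (pushforward (@lebesgue_measure R) f).
pose m := m' mf.
have -> : lebesgue_measure A = m A.
  apply: lebesgue_measure_unique => // _ [[x y]] _ <-.
  rewrite (_ : m _ = a%:E * lebesgue_measure (f @^-1` `]x, y]))//.
  have -> : (f @^-1` `]x, y] =
     `](x - b) / a, (y - b) / a]%classic)%R.
    apply/seteqP; split => z /=; rewrite /f !in_itv/=.
      by rewrite ltr_pdivrMr// ler_pdivlMr// ltrBlDr lerBrDr mulrC.
    by rewrite ltr_pdivrMr// ler_pdivlMr// ltrBlDr lerBrDr mulrC.
  rewrite !lebesgue_measure_itv/= !lte_fin ltr_pM2r ?invr_gt0// ltrD2r.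
  case: ifPn => _; last by rewrite mule0.
  by rewrite -!EFinB -EFinM; congr EFin; field.
by rewrite (_ : m _ = a%:E * lebesgue_measure (f @^-1` A))// muleA -EFinM mulVf// mul1e.
Qed.

Lemma ge0_integral_affine (a b : R) (f : R -> \bar R) : (0 < a)%R ->
  measurable_fun setT f -> (forall x, 0 <= f x) ->
  \int[lebesgue_measure]_x f (a * x + b)%R
  = (a^-1)%:E * \int[lebesgue_measure]_x f x.
Proof.
move=> a0 mf f0.
have mg := measurable_affine a b.
have ai0 : (0 <= a^-1)%R by rewrite invr_ge0 ltW.
have := ge0_integral_pushforward mg (@lebesgue_measure R) measurableT mf (in1W f0).
rewrite preimage_setT => <-.
rewrite (eq_measure_integral (mscale (NngNum ai0) (@lebesgue_measure R))).
  by rewrite ge0_integral_mscale.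
by move=> A mA _; rewrite /= lebesgue_measure_affine.
Qed.

Definition affine2 (a b c : R) (p : measurableTypeR R * measurableTypeR R) :
    measurableTypeR R * measurableTypeR R :=
  (a * p.1 + b, a * p.2 + c)%R.

Lemma measurable_affine2 (a b c : R) :
  measurable_fun setT (affine2 a b c).
Proof.
apply/measurable_fun_pairP; split.
  by apply: measurable_funD => //; exact: measurable_funM.
by apply: measurable_funD => //; exact: measurable_funM.
Qed.

Lemma leb2X (U V : set (measurableTypeR R)) : measurable U -> measurable V ->
  leb2 (U `*` V) = lebesgue_measure U * lebesgue_measure V.
Proof. by move=> mU mV; rewrite -product_measure1E. Qed.

Lemma ge0_integral_affine2 (a b c : R) (f : R * R -> \bar R) : (0 < a)%R ->
  measurable_fun setT
    (f : measurableTypeR R * measurableTypeR R -> \bar R) ->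
  (forall x, 0 <= f x) ->
  \int[leb2]_p f (affine2 a b c p) = (a ^- 2)%:E * \int[leb2]_p f p.
Proof.
move=> a0 mf f0.
have an0 : a != 0%R by rewrite gt_eqF.
have mg := @measurable_affine2 a b c.
have ai0 : (0 <= a ^- 2)%R by rewrite invr_ge0 exprn_ge0// ltW.
have a2 : (0 <= a ^+ 2)%R by rewrite exprn_ge0// ltW.
have := ge0_integral_pushforward mg (@leb2 R) measurableT mf (in1W f0).
rewrite preimage_setT => <-.
rewrite (eq_measure_integral (mscale (NngNum ai0) (@leb2 R))).
  by rewrite ge0_integral_mscale.
move=> A mA _.
(* [a ^+ 2] times the push-forward has the values of [leb2] on rectangles, so the two measures
   coincide. *)
pose m' : {measure set (measurableTypeR R * measurableTypeR R) -> \bar R} :=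
  mscale (NngNum a2) (pushforward leb2 (affine2 a b c)).
pose m := m' mg.
have E : leb2 A = m A.
  apply: product_measure_unique => // U V mU mV.
  rewrite (_ : m _ = (a ^+ 2)%:E * leb2 (affine2 a b c @^-1` (U `*` V)))//.
  have -> : (affine2 a b c @^-1` (U `*` V) =
    ((fun x => a * x + b)%R @^-1` U) `*` ((fun x => a * x + c)%R @^-1` V)).
    by apply/seteqP; split.
  have mgf := measurable_affine a.
  rewrite leb2X//; last 2 first.
    by rewrite -[X in measurable X]setTI; exact: mgf.
    by rewrite -[X in measurable X]setTI; exact: mgf.
  rewrite [X in _ * (X * _)](lebesgue_measure_affine b a0 mU).
  rewrite [X in _ * (_ * X)](lebesgue_measure_affine c a0 mV).
  have E (x y : \bar R) :
      (a ^+ 2)%:E * ((a^-1)%:E * x * ((a^-1)%:E * y)) = x * y.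
    have -> : x * y = (a ^+ 2 * (a^-1 * a^-1))%:E * (x * y).
      by rewrite (_ : a ^+ 2 * _ = 1)%R ?mul1e//; field.
    by rewrite [in RHS]EFinM [in RHS](EFinM (a^-1)%R) -[RHS]muleA [X in _ * X = _]muleACA.
  exact: E.
transitivity ((a ^- 2)%:E * m A); last by rewrite -E.
rewrite (_ : m _ = (a ^+ 2)%:E * leb2 (affine2 a b c @^-1` A))// muleA -EFinM mulVf ?mul1e//.
by rewrite expf_neq0.
Qed.

End integral_tools.

(** * One-dimensional Hausdorff measure in the plane *)

Section euclid.
Context {R : realType}.
Implicit Types (p q : R * R) (U S : set (R * R)) (d : R).

Lemma le_euclid_dist1 p q : `|p.1 - q.1| <= euclid_dist p q.
Proof. by rewrite -sqrtr_sqr ler_wsqrtr// lerDl sqr_ge0. Qed.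

Lemma le_euclid_dist2 p q : `|p.2 - q.2| <= euclid_dist p q.
Proof. by rewrite -sqrtr_sqr ler_wsqrtr// lerDr sqr_ge0. Qed.

Lemma euclid_dist_scale (r a b : R) p q : 0 <= r ->
  euclid_dist (r * p.1 + a, r * p.2 + b) (r * q.1 + a, r * q.2 + b) =
  r * euclid_dist p q.
Proof.
move=> r0; rewrite /euclid_dist /=.
have -> : (r * p.1 + a - (r * q.1 + a)) ^+ 2 + (r * p.2 + b - (r * q.2 + b)) ^+ 2
  = r ^+ 2 * ((p.1 - q.1) ^+ 2 + (p.2 - q.2) ^+ 2) by ring.
by rewrite sqrtrM ?sqr_ge0// sqrtr_sqr ger0_norm.
Qed.

Lemma euclid_dist_square p q :
  0 <= p.1 <= 1 -> 0 <= p.2 <= 1 -> 0 <= q.1 <= 1 -> 0 <= q.2 <= 1 ->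
  euclid_dist p q <= Num.sqrt 2.
Proof.
move=> /andP[? ?] /andP[? ?] /andP[? ?] /andP[? ?].
have sq1 (x y : R) : 0 <= x <= 1 -> 0 <= y <= 1 -> (x - y) ^+ 2 <= 1 by nra.
by apply: ler_wsqrtr; rewrite -[2]/(1 + 1) lerD//; apply: sq1; apply/andP.
Qed.

Local Open Scope ereal_scope.

Lemma euclid_diam_ge0 U : 0 <= euclid_diam U.
Proof. by apply: ereal_sup_ubound; left. Qed.

Lemma euclid_dist_le_diam U p q : U p -> U q ->
  (euclid_dist p q)%:E <= euclid_diam U.
Proof. by move=> Up Uq; apply: ereal_sup_ubound; right; exists p => //; exists q. Qed.

Lemma euclid_diam_le U (x : \bar R) : 0 <= x ->
  (forall p q, U p -> U q -> (euclid_dist p q)%:E <= x) -> euclid_diam U <= x.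
Proof.
by move=> x0 Ux; apply: ge_ereal_sup => _ [->//|[p Up [q Uq <-]]]; exact: Ux.
Qed.

Lemma le_euclid_diam U S : U `<=` S -> euclid_diam U <= euclid_diam S.
Proof.
move=> US; apply: euclid_diam_le => [|p q Up Uq]; first exact: euclid_diam_ge0.
by apply: euclid_dist_le_diam; exact: US.
Qed.

Lemma euclid_diam0 : euclid_diam (@set0 (R * R)) = 0.
Proof.
by apply/eqP; rewrite eq_le euclid_diam_ge0 andbT; exact: euclid_diam_le.
Qed.

Lemma hausdorff1_pre_ge0 d S : 0 <= hausdorff1_pre d S.
Proof.
apply: le_ereal_inf_tmp => _ [F _ <-]; apply: nneseries_ge0 => n _ _.
exact: euclid_diam_ge0.
Qed.

Lemma le_hausdorff1_pre d U S : U `<=` S ->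
  hausdorff1_pre d U <= hausdorff1_pre d S.
Proof.
move=> US; apply: ereal_inf_le_tmp => _ [F [SF Fd] <-].
by exists F => //; split => //; exact: subset_trans SF.
Qed.

Lemma hausdorff1_pre_anti d d' S : (d <= d')%R ->
  hausdorff1_pre d' S <= hausdorff1_pre d S.
Proof.
move=> dd'; apply: ereal_inf_le_tmp => _ [F [SF Fd] <-].
by exists F => //; split => // k; apply: le_trans (Fd k) _; rewrite lee_fin.
Qed.

Lemma hausdorff1_pre_le_diam d S : (0 <= d)%R -> euclid_diam S <= d%:E ->
  hausdorff1_pre d S <= euclid_diam S.
Proof.
move=> d0 Sd; apply: ereal_inf_lbound.
exists (fun k => if k is 0%N then S else set0).
  split => [p Sp|[|k]//]; first by exists 0%N.
  by rewrite euclid_diam0 lee_fin.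
rewrite (@nneseries_split _ _ 0 1); last by move=> k _; exact: euclid_diam_ge0.
by rewrite big_nat1 eseries0 ?adde0// => -[|k]// _ _; rewrite euclid_diam0.
Qed.

Lemma hausdorff1_pre_subsingleton d S : (0 <= d)%R ->
  (forall p q, S p -> S q -> p = q) -> hausdorff1_pre d S = 0.
Proof.
move=> d0 S1; have S0 : euclid_diam S <= 0.
  apply: euclid_diam_le => // p q Sp Sq; rewrite (S1 _ _ Sp Sq).
  by rewrite /euclid_dist !subrr expr0n addr0 sqrtr0.
apply/eqP; rewrite eq_le hausdorff1_pre_ge0 andbT; apply: (le_trans _ S0).
by apply: hausdorff1_pre_le_diam => //; rewrite (le_trans S0)// lee_fin.
Qed.

(* Giving infinite weight to the sets of diameter larger than [d] turns the
   size-restricted covers of [hausdorff1_pre] into arbitrary ones. *)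
Let rho d U : \bar R := if euclid_diam U <= d%:E then euclid_diam U else +oo.

Let rho_ge0 d U : 0 <= rho d U.
Proof. by rewrite /rho; case: ifP => // _; exact: euclid_diam_ge0. Qed.

Let rho0 d : (0 <= d)%R -> rho d set0 = 0.
Proof. by move=> d0; rewrite /rho euclid_diam0 lee_fin d0. Qed.

(** [mu_ext] admits only covers by measurable sets; here every set is measurable, so no cover is
    lost. *)
Let discrete := g_sigma_algebraType (@setT (set (R * R))).

Let measurable_discrete (U : set discrete) : measurable U.
Proof. exact: sub_sigma_algebra. Qed.

Let hausdorff1_preE d : (0 <= d)%R ->
  hausdorff1_pre d = mu_ext (rho d : set discrete -> \bar R).
Proof.
move=> d0; apply/funext => S; apply/eqP; rewrite eq_le; apply/andP; split.
  apply: le_ereal_inf_tmp => _ [F [_ SF] <-].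
  have [Fd|/existsNP[k Fk]] := pselect (forall k, euclid_diam (F k) <= d%:E).
    apply: ereal_inf_lbound; exists F => //; apply: eq_eseriesr => k _.
    by rewrite /rho Fd.
  rewrite (@eseries_pinfty _ _ _ k) ?leey//; last first.
    by rewrite /rho ifF//; apply/negP.
  by move=> n _; rewrite gt_eqF// (lt_le_trans _ (rho_ge0 _ _))// ltNy0.
apply: ereal_inf_le_tmp => _ [F [SF Fd] <-]; exists F.
  by split => // k; exact: measurable_discrete.
by apply: eq_eseriesr => k _; rewrite /rho Fd.
Qed.

Lemma hausdorff1_preU d U S : (0 <= d)%R ->
  hausdorff1_pre d (U `|` S) <= hausdorff1_pre d U + hausdorff1_pre d S.
Proof.
move=> d0; rewrite hausdorff1_preE//.
pose M : set discrete -> \bar R := mu_ext (rho d : set discrete -> \bar R).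
have M0 : M set0 = 0 by exact: (@mu_ext0 _ discrete R (rho d) (rho0 d0) (rho_ge0 d)).
have Mge0 X : 0 <= M X by exact: (@mu_ext_ge0 _ discrete R (rho d) (rho_ge0 d)).
have Mle : {homo M : A B / A `<=` B >-> A <= B} by exact: (@le_mu_ext _ discrete R (rho d)).
have Msub : sigma_subadditive M by exact: (@mu_ext_sigma_subadditive _ discrete R (rho d) (rho_ge0 d)).
pose m : {outer_measure set discrete -> \bar R} :=
  HB.pack M (isOuterMeasure.Build R discrete M M0 Mge0 Mle Msub).
exact: (outer_measureU2 m).
Qed.

Lemma hausdorff1_pre_le_sum d (I : finType) (F : I -> set (R * R)) S :
  (0 <= d)%R -> (forall p, S p -> exists i, F i p) ->
  hausdorff1_pre d S <= \sum_i hausdorff1_pre d (F i).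
Proof.
move=> d0 SF; rewrite -big_enum/=.
have {SF} : S `<=` [set p | exists2 i, i \in enum I & F i p].
  by move=> p /SF[i Fip]; exists i; rewrite ?mem_enum.
elim: (enum I) S => [S SF|i r ih S SF].
  rewrite big_nil hausdorff1_pre_subsingleton//.
  by move=> p q /SF /= [i]; rewrite in_nil.
rewrite big_cons; apply: (le_trans _ (leeD2l _ (ih _ (@subset_refl _ _)))).
apply: (le_trans _ (hausdorff1_preU _ _ d0)); apply: le_hausdorff1_pre.
move=> p /SF /= [j]; rewrite inE => /orP[/eqP ->|jr Fjp]; first by left.
by right; exists j.
Qed.

Lemma hausdorff1_pre_lipschitz d (K : R) (g : R * R -> R * R) S : (0 < K)%R ->
  (forall p q, S p -> S q -> (euclid_dist (g p) (g q) <= K * euclid_dist p q)%R) ->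
  hausdorff1_pre (K * d) (g @` S) <= K%:E * hausdorff1_pre d S.
Proof.
move=> K0 gK; rewrite -lee_pdivrMl//; apply: le_ereal_inf_tmp => _ [F [SF Fd] <-].
have gF k : euclid_diam (g @` (S `&` F k)) <= K%:E * euclid_diam (F k).
  apply: euclid_diam_le => [|_ _ [p [Sp Fp] <-] [q [Sq Fq] <-]].
    by apply: mule_ge0; [rewrite lee_fin ltW|exact: euclid_diam_ge0].
  apply: (@le_trans _ _ (K * euclid_dist p q)%:E); first by rewrite lee_fin gK.
  by rewrite EFinM lee_pmul2l// euclid_dist_le_diam.
rewrite lee_pdivrMl// -nneseriesZl//; last by move=> k _; exact: euclid_diam_ge0.
apply: (@le_trans _ _ (\sum_(0 <= k <oo) euclid_diam (g @` (S `&` F k)))).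
  apply: ereal_inf_lbound; exists (fun k => g @` (S `&` F k)) => //; split.
    by move=> _ [p Sp <-]; have [k _ Fp] := SF _ Sp; exists k => //; exists p.
  move=> k; apply: le_trans (gF k) _.
  by rewrite EFinM lee_pmul2l//; exact: Fd.
by apply: lee_nneseries => [k _ _|k _]; [exact: euclid_diam_ge0|exact: gF].
Qed.

(** A covering set of diameter at most [d] meets at most one [F i], so its diameter is charged to a
    single index. *)
Lemma hausdorff1_pre_separated d (I : finType) (F : I -> set (R * R)) S :
  (forall i, F i `<=` S) ->
  (forall i j p q, i != j -> F i p -> F j q -> (d < euclid_dist p q)%R) ->
  \sum_i hausdorff1_pre d (F i) <= hausdorff1_pre d S.
Proof.
move=> FS Fsep; apply: le_ereal_inf_tmp => _ [G [SG Gd] <-].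
apply: (@le_trans _ _ (\sum_i \sum_(0 <= k <oo) euclid_diam (G k `&` F i))).
  apply: lee_sum => i _; apply: ereal_inf_lbound.
  exists (fun k => G k `&` F i) => //; split.
    by move=> p Fp; have [k _ Gp] := SG _ (FS _ _ Fp); exists k.
  by move=> k; apply: le_trans (Gd k); exact: le_euclid_diam.
rewrite -nneseries_sum; last by move=> *; exact: euclid_diam_ge0.
apply: lee_nneseries => [k _ _|k _].
  by apply: sume_ge0 => *; exact: euclid_diam_ge0.
have [[i [p [Gp Fp]]]|GF] := pselect (exists i, (G k `&` F i) !=set0).
  rewrite (bigD1 i)//= big1 ?adde0; first exact: le_euclid_diam.
  move=> j ji; rewrite (_ : _ `&` _ = set0) ?euclid_diam0//.
  apply/seteqP; split => // q [Gq Fq].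
  have := le_trans (euclid_dist_le_diam Gq Gp) (Gd k).
  by rewrite lee_fin leNgt (Fsep _ _ _ _ ji Fq Fp).
rewrite big1 ?euclid_diam_ge0// => i _; rewrite (_ : _ `&` _ = set0) ?euclid_diam0//.
by apply/seteqP; split => // p GFp; apply: GF; exists i, p.
Qed.

(** The interval is halved until the bound [K * (b - a)] on the diameter of a piece drops to [d];
    the bounds of the two halves add up exactly. *)
Lemma hausdorff1_pre_segment_le d (K a b : R) (g : R -> R * R) :
  (0 < d)%R -> (0 <= K)%R -> (a <= b)%R ->
  (forall r s, (euclid_dist (g r) (g s) <= K * `|r - s|)%R) ->
  hausdorff1_pre d (g @` `[a, b]) <= (K * (b - a))%:E.
Proof.
move=> d0 K0 ab gK; move: (ab).
have [n] : exists n, (K * (b - a) <= 2 ^+ n * d)%R.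
  exists (Num.bound (K * (b - a) / d)); rewrite -ler_pdivrMr//.
  apply: le_trans (ltW (archi_boundP _)) _.
    by rewrite divr_ge0 ?mulr_ge0 ?subr_ge0 ?(ltW d0).
  by rewrite -natrX ler_nat ltnW// ltn_expl.
elim: n a b {ab} => [|n ih] a b.
  rewrite expr0 mul1r => Kab ab.
  have dab : euclid_diam (g @` `[a, b]) <= (K * (b - a))%:E.
    apply: euclid_diam_le => [|_ _ [r /= rab <-] [s /= sab <-]].
      by rewrite lee_fin mulr_ge0// subr_ge0.
    rewrite lee_fin; apply: le_trans (gK _ _) _; rewrite ler_wpM2l//.
    move: rab sab; rewrite !in_itv/= => /andP[? ?] /andP[? ?].
    by rewrite ler_norml; apply/andP; split; lra.
  apply: (le_trans _ dab); apply: hausdorff1_pre_le_diam; first exact: ltW.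
  by apply: le_trans dab _; rewrite lee_fin.
move=> Kab ab; pose c := ((a + b) / 2)%R.
rewrite (_ : `[a, b] = `[a, c] `|` `[c, b])%classic; last first.
  apply/seteqP; split => r /=; rewrite !in_itv/= /c.
    by move=> /andP[? ?]; have [?|/ltW ?] := leP r c; [left|right]; apply/andP; split.
  by move=> [] /andP[? ?]; apply/andP; split; lra.
rewrite image_setU; apply: le_trans (hausdorff1_preU _ _ (ltW d0)) _.
have -> : (K * (b - a) = K * (c - a) + K * (b - c))%R by rewrite /c; ring.
rewrite EFinD; apply: leeD; apply: ih; rewrite /c.
- by move: Kab; rewrite exprS; nra.
- by lra.
- by move: Kab; rewrite exprS; nra.
- by lra.
Qed.

(** A covering set of diameter [D k] has a preimage under [g] of diameter at most [D k / K], and by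
    countable subadditivity of Lebesgue measure the preimages have total length at least [b - a]. *)
Lemma hausdorff1_pre_segment_ge d (K a b : R) (g : R -> R * R) :
  (0 < K)%R -> (a <= b)%R ->
  (forall r s, (K * `|r - s| <= euclid_dist (g r) (g s))%R) ->
  (K * (b - a))%:E <= hausdorff1_pre d (g @` `[a, b]).
Proof.
move=> K0 ab gK; apply: le_ereal_inf_tmp => _ [F [SF Fd] <-].
pose E k := [set r | (g r) \in F k].
pose D k := fine (euclid_diam (F k)).
have DE k : euclid_diam (F k) = (D k)%:E.
  rewrite fineK// ge0_fin_numE ?euclid_diam_ge0//.
  by apply: le_lt_trans (Fd k) _; rewrite ltry.
have D0 k : (0 <= D k)%R by rewrite -lee_fin -DE euclid_diam_ge0.
(* The preimage [E k] need not be measurable, so it is enclosed in an interval that starts at its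
   infimum. *)
have EI k : exists c : R, E k `<=` `[c, (c + K^-1 * D k)%R]%classic.
  have [[r0 Er0]|E0] := pselect (E k !=set0); last first.
    by exists 0%R => r Er; exfalso; apply: E0; exists r.
  have diffE r s : E k r -> E k s -> (s <= r + K^-1 * D k)%R.
    rewrite /E /= !inE => Er Es.
    have : (K * `|r - s| <= D k)%R.
      apply: le_trans (gK r s) _.
      by rewrite -lee_fin -DE; exact: euclid_dist_le_diam.
    rewrite -lerBlDl ler_pdivlMl//; apply: le_trans.
    by apply: ler_wpM2l; [exact: ltW|rewrite distrC ler_norm].
  have Einf : has_inf (E k).
    split; first by exists r0.
    by exists (r0 - K^-1 * D k)%R => r Er; rewrite lerBlDr; exact: diffE.
  exists (inf (E k)) => r Er /=; rewrite in_itv/=; apply/andP; split.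
    by apply: ge_inf => //; case: Einf.
  rewrite -lerBlDr; apply: lb_le_inf; first by exists r0.
  by move=> s Es; rewrite lerBlDr; exact: diffE.
have [c cE] := choice EI.
rewrite EFinM -lee_pdivlMl//.
have -> : (b - a)%:E = lebesgue_measure `[a, b]%classic.
  by rewrite lebesgue_measure_itv/= lte_fin -EFinB; case: ltgtP ab => // ->; rewrite subrr.
rewrite -nneseriesZl//; last by move=> k _; exact: euclid_diam_ge0.
apply: (@le_trans _ _ (\sum_(0 <= k <oo) lebesgue_measure `[c k, (c k + K^-1 * D k)%R]%classic)).
  apply: measure_sigma_subadditive => // r rab.
  have [|k _ Fr] := SF (g r); first by exists r.
  by exists k => //; apply: cE; rewrite /E /= inE.
apply: lee_nneseries => [//|k _].
rewrite lebesgue_measure_itv/= DE lte_fin -EFinM; case: ifPn => _.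
  by rewrite -EFinB addrAC subrr add0r.
by rewrite lee_fin mulr_ge0// invr_ge0 ltW.
Qed.

End euclid.

(** * Copulas and their values on grid cells *)

Section copula_basics.
Context {R : realType} (A : copula R).
Implicit Types (x y : R).
Local Notation mu := (copula_measure A).
Local Notation R2 := (measurableTypeR R * measurableTypeR R)%type.

(** The distribution function of the uniform law on [0, 1], hence of both margins of a copula
    measure. *)
Definition clamp x : R := Num.max 0 (Num.min x 1).

Lemma clamp_le0 x : x <= 0 -> clamp x = 0.
Proof. by move=> x0; rewrite /clamp min_l ?max_l//; lra. Qed.

Lemma clamp_ge1 x : 1 <= x -> clamp x = 1.
Proof. by move=> x1; rewrite /clamp min_r ?max_r//; lra. Qed.

Lemma clamp_id x : 0 <= x <= 1 -> clamp x = x.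
Proof. by move=> /andP[? ?]; rewrite /clamp min_l ?max_r. Qed.

Lemma measurable_I01 : measurable (I01 : set (measurableTypeR R)).
Proof. exact: measurable_itv. Qed.

Lemma measurable_square : measurable (square : set R2).
Proof. by apply: measurableX; exact: measurable_I01. Qed.

Lemma leb_I01 : leb (I01 : set R) = 1%E.
Proof. by rewrite /leb lebesgue_measure_itv/= lte_fin ltr01 oppr0 adde0. Qed.

Lemma copula_square : mu square = 1%E.
Proof. by have [-> _] := copula_measureP A measurable_I01 (@subset_refl _ _); exact: leb_I01. Qed.

Lemma copula_setI_square (S : set R2) : measurable S ->
  mu (S `&` square) = mu S.
Proof.
move=> mS; have mq := measurable_square.
have C0 : mu (~` square) = 0%E.
  rewrite probability_setC//.
  by rewrite copula_square subee.
have D0 : mu (S `\` square) = 0%E.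
  apply: (subset_measure0 _ _ _ C0); [exact: measurableD|exact: measurableC|].
  by move=> p [].
by rewrite [RHS](measureDI mu mS mq) /= D0 add0e.
Qed.

Lemma copula_eq_on_square (S S' : set R2) : measurable S -> measurable S' ->
  (forall p, square p -> S p <-> S' p) -> mu S = mu S'.
Proof.
move=> mS mS' SS'; rewrite -copula_setI_square// -[RHS]copula_setI_square//.
by congr (mu _); apply/seteqP; split => p [Sp sp]; split => //; apply/(SS' p).
Qed.

(* Unlike [0, x] x [0, y], these sets generate the Borel sets of the plane. *)
Definition quadrant x y : set R2 := `]-oo, x] `*` `]-oo, y].

Lemma measurable_quadrant x y : measurable (quadrant x y).
Proof. by apply: measurableX; exact: measurable_itv. Qed.

(** The two sets agree on the square, which carries all the mass. Thus [A] is a distribution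
    function on the whole plane, and formulas with shifted arguments need no truncation. *)
Lemma copulaE x y : A x y = fine (mu (quadrant x y)).
Proof.
rewrite /copula_fun /joint_cdf; congr fine; apply: copula_eq_on_square.
- by apply: measurableX; exact: measurable_itv.
- exact: measurable_quadrant.
- move=> [u v] [] /=; rewrite /I01 /= !in_itv/= => /andP[u0 _] /andP[v0 _].
  by rewrite /I01 /quadrant /= !in_itv/= u0 v0.
Qed.

Lemma copula_quadrantE x y : mu (quadrant x y) = (A x y)%:E.
Proof. by rewrite copulaE fineK// fin_num_measure//; exact: measurable_quadrant. Qed.

Lemma copula_strip1 (E : set (measurableTypeR R)) : measurable E ->
  mu (E `*` setT) = leb (E `&` I01).
Proof.
move=> mE; have mEI : measurable (E `&` I01) by apply: measurableI => //; exact: measurable_I01.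
have [<- _] := copula_measureP A mEI (@subIsetr _ _ _).
apply: copula_eq_on_square; [exact: measurableX| |].
  by apply: measurableX => //; exact: measurable_I01.
by move=> [u v] [/= uI vI]; split => [[/= Eu _]|[/= [Eu _] _]]; split.
Qed.

Lemma copula_strip2 (E : set (measurableTypeR R)) : measurable E ->
  mu (setT `*` E) = leb (E `&` I01).
Proof.
move=> mE; have mEI : measurable (E `&` I01) by apply: measurableI => //; exact: measurable_I01.
have [_ <-] := copula_measureP A mEI (@subIsetr _ _ _).
apply: copula_eq_on_square; [exact: measurableX| |].
  by apply: measurableX => //; exact: measurable_I01.
by move=> [u v] [/= uI vI]; split => [[/= _ Eu]|[/= _ [Eu _]]]; split.
Qed.

Lemma leb_ray_I01 x : leb (`]-oo, x]%classic `&` I01) = (clamp x)%:E.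
Proof.
have [x0|x0] := ltP x 0.
  rewrite (_ : _ `&` _ = set0) ?measure0 ?clamp_le0 ?ltW//.
    exact: measure0.
  by apply/seteqP; split => // z []; rewrite /I01 /= !in_itv/= => ? /andP[? ?]; lra.
have [x1|x1] := leP x 1.
  rewrite (_ : _ `&` _ = `[0, x]%classic); last first.
    apply/seteqP; split => z /=; rewrite /I01/= !in_itv/=.
      by case=> -> /andP[->].
    by move=> /andP[? ?]; split => //; apply/andP; split; lra.
  rewrite clamp_id ?x0// /leb lebesgue_measure_itv/= lte_fin.
  by case: ltgtP x0 => // [_|<-] _; rewrite ?oppr0 ?adde0.
rewrite (_ : _ `&` _ = I01) ?clamp_ge1 ?leb_I01 1?ltW//.
apply/seteqP; split => z //=; first by case.
by rewrite /I01/= !in_itv/= => /andP[? ?]; split; [lra|apply/andP].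
Qed.

Lemma copula_mono x x' y y' : x <= x' -> y <= y' -> A x y <= A x' y'.
Proof.
move=> xx' yy'; rewrite -lee_fin -!copula_quadrantE le_measure ?inE//;
  [exact: measurable_quadrant|exact: measurable_quadrant|].
by move=> [u v] []; rewrite /I01 /quadrant /= !in_itv/= => ? ?; split; lra.
Qed.

Lemma copula_ge1l x y : 1 <= x -> A x y = clamp y.
Proof.
move=> x1; apply: EFin_inj; rewrite -copula_quadrantE -leb_ray_I01 -copula_strip2//.
apply: copula_eq_on_square => //; first exact: measurable_quadrant.
  by apply: measurableX => //.
move=> [u v] []; rewrite /I01 /quadrant /= !in_itv/= => /andP[_ ?] _.
by split => [[]//|[_ ?]]; split => //; lra.
Qed.

Lemma copula_ge1r x y : 1 <= y -> A x y = clamp x.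
Proof.
move=> x1; apply: EFin_inj; rewrite -copula_quadrantE -leb_ray_I01 -copula_strip1//.
apply: copula_eq_on_square => //; first exact: measurable_quadrant.
  by apply: measurableX => //.
move=> [u v] []; rewrite /I01 /quadrant /= !in_itv/= => _ /andP[_ ?].
by split => [[]//|[? _]]; split => //; lra.
Qed.

Lemma copula_ge0 x y : 0 <= A x y.
Proof. by rewrite -lee_fin -copula_quadrantE. Qed.

Lemma copula_le0l x y : x <= 0 -> A x y = 0.
Proof.
move=> x0; apply/eqP; rewrite eq_le copula_ge0 andbT.
rewrite -(clamp_le0 x0) -(@copula_ge1r x (Num.max y 1)) ?copula_mono// le_max lexx//.
by rewrite orbT.
Qed.

Lemma copula_le0r x y : y <= 0 -> A x y = 0.
Proof.
move=> x0; apply/eqP; rewrite eq_le copula_ge0 andbT.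
rewrite -(clamp_le0 x0) -(@copula_ge1l (Num.max x 1)) ?copula_mono// le_max lexx//.
by rewrite orbT.
Qed.

Lemma copula_le1 x y : A x y <= 1.
Proof.
apply: (@le_trans _ _ (A (Num.max x 1) y)).
  by rewrite copula_mono// le_max lexx.
rewrite copula_ge1l ?le_max ?lexx ?orbT// /clamp.
by rewrite ge_max ler01 ge_min lexx orbT.
Qed.

Lemma leb_itv_I01_le x x' : x <= x' ->
  (leb (`]x, x']%classic `&` I01) <= (x' - x)%:E)%E.
Proof.
move=> xx'; apply: (@le_trans _ _ (leb `]x, x']%classic)).
  apply: le_measure; rewrite ?inE//.
  by apply: measurableI => //; exact: measurable_I01.
rewrite /leb lebesgue_measure_itv/= lte_fin -EFinB.
by case: ifPn => // _; rewrite lee_fin subr_ge0.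
Qed.

(** The difference is at most the mass of the vertical strip over []x, x']], which the uniform
    margin bounds by its width. *)
Lemma copula_lip1 x x' y : x <= x' -> A x' y <= A x y + (x' - x).
Proof.
move=> xx'; rewrite -lee_fin EFinD -!copula_quadrantE.
apply: le_trans (leeD2l _ (leb_itv_I01_le xx')).
rewrite -copula_strip1//.
have mq := measurable_quadrant.
apply: le_trans (measureU2 _ _ _) => //; last exact: measurableX.
apply: le_measure; rewrite ?inE//; first by apply: measurableU => //; exact: measurableX.
move=> [u v] []; rewrite /I01 /quadrant /= !in_itv/= => ux vy.
by have [uix|uix] := leP u x; [left|right]; split => //=; rewrite in_itv/= ?uix.
Qed.

Lemma copula_lip2 x y y' : y <= y' -> A x y' <= A x y + (y' - y).
Proof.
move=> xx'; rewrite -lee_fin EFinD -!copula_quadrantE.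
apply: le_trans (leeD2l _ (leb_itv_I01_le xx')).
rewrite -copula_strip2//.
have mq := measurable_quadrant.
apply: le_trans (measureU2 _ _ _) => //; last exact: measurableX.
apply: le_measure; rewrite ?inE//; first by apply: measurableU => //; exact: measurableX.
move=> [u v] []; rewrite /I01 /quadrant /= !in_itv/= => ux vy.
by have [uix|uix] := leP v y; [left|right]; split => //=; rewrite in_itv/= ?uix.
Qed.

End copula_basics.

(** * The fixed-point equation on the cells of the grid *)

Section cells.
Context {R : realType} (N : nat) (pi : 'S_N) (N_gt1 : (2 <= N)%N).
Implicit Types (x y u v : R) (i j k : 'I_N) (B : copula R).

Let N_gt0 : 0 < N%:R :> R.
Proof. by rewrite ltr0n ltnW. Qed.

Lemma joint_cdf_Vop B x y :
  joint_cdf (Vop pi (copula_measure B)) x y =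
  N%:R^-1 * \sum_(i < N) B (N%:R * x - (pi i)%:R) (N%:R * y - i%:R).
Proof.
rewrite /joint_cdf /Vop exchange_big/=.
transitivity (fine (\sum_(i < N) (N%:R^-1 *
    B (N%:R * x - (pi i)%:R) (N%:R * y - i%:R))%:E)%E); last first.
  by rewrite sumEFin/= mulr_sumr.
congr fine; apply: eq_bigr => i _.
rewrite (bigD1 (pi i))//= big1 ?adde0; last first.
  by move=> j ji; rewrite mxE eq_sym (negbTE ji) mul0e.
rewrite mxE eqxx EFinM; congr (_ * _)%E.
rewrite -copula_quadrantE /pushforward; apply: copula_eq_on_square.
- rewrite (_ : _ @^-1` _ =
    `[- (pi i)%:R, N%:R * x - (pi i)%:R] `*` `[- i%:R, N%:R * y - i%:R]); last first.
    apply/seteqP; split => -[u v] []; rewrite /cell_map /= !in_itv/=.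
      rewrite !ler_pdivlMr// !ler_pdivrMr// !mul0r => /andP[? ?] /andP[? ?].
      by split; apply/andP; split; lra.
    move=> /andP[? ?] /andP[? ?].
    by split; rewrite !ler_pdivlMr// !ler_pdivrMr// !mul0r; apply/andP; split; lra.
  by apply: measurableX; exact: measurable_itv.
- exact: measurable_quadrant.
- move=> [u v] [] /=; rewrite /I01 /cell_map /quadrant /= !in_itv/= => /andP[? ?] /andP[? ?].
  have pi0 : 0 <= (pi i)%:R :> R by [].
  have i0 : 0 <= i%:R :> R by [].
  rewrite !ler_pdivlMr// !ler_pdivrMr// !mul0r.
  by split => [[/andP[? ?] /andP[? ?]]|[? ?]]; [split; lra|split; apply/andP; split; lra].
Qed.

(* [cell_base], [slope1] and [slope2] are the coefficients c, a, b of
   N A = c + a u + b v on the cell in column j and row k. *)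
Definition cell_base j k : nat := \sum_(i < N) ((pi i < j)%N && (i < k)%N).

Definition slope1 j k : bool := ((pi^-1)%g j < k)%N.

Definition slope2 j k : bool := (pi k < j)%N.

(** In the [i]-th summand of [joint_cdf_Vop] the first argument is at least 1, equal to [u] or at
    most 0 according as [pi i] is less than, equal to or greater than [j]; likewise the second, with
    [i] and [k]. Uniform margins turn the summand into 1, [u], [v], [B u v] or 0. *)
Lemma joint_cdf_Vop_cell B j k u v : 0 <= u <= 1 -> 0 <= v <= 1 ->
  joint_cdf (Vop pi (copula_measure B)) ((j%:R + u) / N%:R) ((k%:R + v) / N%:R) =
  N%:R^-1 * ((cell_base j k)%:R + (slope1 j k)%:R * u + (slope2 j k)%:R * v
             + (pi k == j)%:R * B u v).
Proof.
move=> uI vI; rewrite joint_cdf_Vop; congr (_ * _).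
have N0 : N%:R != 0 :> R by rewrite gt_eqF.
transitivity (\sum_(i < N) (((pi i < j)%N && (i < k)%N)%:R
   + (if pi i == j then (i < k)%N%:R * u else 0)
   + (if i == k then (pi i < j)%N%:R * v else 0)
   + (if i == k then (pi i == j)%:R * B u v else 0)) : R).
  apply: eq_bigr => i _.
  rewrite ![N%:R * (_ / _)]mulrC !divfK//.
  have -> : (pi i == j) = (pi i == j :> nat) by [].
  have -> : (i == k) = (i == k :> nat) by [].
  move: uI vI => /[dup] uI /andP[u0 u1] /[dup] vI /andP[v0 v1].
  have E (m n : nat) (z : R) : (m < n)%N -> 0 <= z -> 1 <= n%:R + z - m%:R.
    move=> mn z0; have : m.+1%:R <= n%:R :> R by rewrite ler_nat.
    by rewrite -natr1; lra.
  have C (m : nat) (z : R) : m%:R + z - m%:R = z by ring.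
  have E' (m n : nat) (z : R) : (n < m)%N -> z <= 1 -> n%:R + z - m%:R <= 0.
    move=> mn z0; have : n.+1%:R <= m%:R :> R by rewrite ler_nat.
    by rewrite -natr1; lra.
  case: (ltngtP (pi i) j) => [pij|pij|->]; last first.
  - rewrite C; case: (ltngtP i k) => [ik|ik|->].
    + by rewrite copula_ge1r ?clamp_id ?E// add0r mul1r !addr0.
    + by rewrite copula_le0r ?E'// mul0r !addr0.
    + by rewrite C !mul0r !add0r mul1r.
  - by rewrite copula_le0l ?E'//=; case: ifP => _; rewrite ?mul0r !addr0.
  - case: (ltngtP i k) => [ik|ik|->].
    + by rewrite copula_ge1r ?clamp_ge1 ?E//= !addr0.
    + by rewrite copula_le0r ?E'// !addr0.
    + by rewrite C copula_ge1l ?clamp_id ?E//= mul1r mul0r !add0r addr0.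
rewrite !big_split/=; congr (_ + _ + _ + _).
- by rewrite /cell_base natr_sum.
- rewrite (bigD1 ((pi^-1)%g j))//= permKV eqxx big1 ?addr0// => i ij.
  by rewrite ifF//; apply: contra_neqF ij => /eqP <-; rewrite permK.
- by rewrite (bigD1 k)//= eqxx big1 ?addr0// => i /negbTE ->.
- by rewrite (bigD1 k)//= eqxx big1 ?addr0// => i /negbTE ->.
Qed.

End cells.

(** * Length of level curves *)

Section level_pieces.
Context {R : realType}.
Implicit Types (s t d e r : R) (p q : R * R) (S : set (R * R)) (a b : bool).

Lemma hausdorff1_pre_set0 d S : 0 <= d -> (forall p, ~ S p) ->
  hausdorff1_pre d S = 0%E.
Proof. by move=> d0 S0; apply: hausdorff1_pre_subsingleton => // p q /S0. Qed.

(** The clause [a || b] empties the set when both slopes vanish: a plateau of [A] contains no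
    boundary point in its interior. *)
Definition linear_level a b s : set (R * R) :=
  [set p | [/\ open_square p, a || b & a%:R * p.1 + b%:R * p.2 = s]].

(** The antidiagonal [u + v = s] meets the unit square in a segment whose first coordinates range
    over an interval of length [min s (2 - s)]; a vertical or horizontal line at [s] in (0, 1) meets
    it in length 1. *)
Definition linear_length a b s : R :=
  if a && b then Num.sqrt 2 * Num.max 0 (Num.min s (2 - s))
  else if a || b then \1_(`]0, 1[%classic) s else 0.

Lemma linear_length_ge0 a b s : 0 <= linear_length a b s.
Proof.
rewrite /linear_length; case: ifP => _; first by rewrite mulr_ge0 ?sqrtr_ge0// le_max lexx.
by case: ifP => // _; rewrite indicE.
Qed.

Lemma euclid_dist_antidiag s r r' :
  euclid_dist (r, s - r) (r', s - r') = Num.sqrt 2 * `|r - r'|.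
Proof.
rewrite /euclid_dist /= -sqrtr_sqr -sqrtrM//; congr Num.sqrt; ring.
Qed.

Lemma euclid_dist_vertical s r r' : euclid_dist (s, r) (s, r') = 1 * `|r - r'|.
Proof. by rewrite /euclid_dist /= subrr expr0n add0r sqrtr_sqr mul1r. Qed.

Lemma euclid_dist_horizontal s r r' : euclid_dist (r, s) (r', s) = 1 * `|r - r'|.
Proof. by rewrite /euclid_dist /= subrr expr0n addr0 sqrtr_sqr mul1r. Qed.

Lemma open_squareE p : open_square p -> (0 < p.1 < 1) /\ (0 < p.2 < 1).
Proof. by case; rewrite /= !in_itv/=. Qed.

Lemma sqrt2_gt0 : 0 < Num.sqrt 2 :> R.
Proof. by rewrite sqrtr_gt0. Qed.

Lemma min2_le s : Num.min s (2 - s) <= Num.min 1 s - Num.max 0 (s - 1).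
Proof.
have [] := leP 0 (s - 1); have [] := leP 1 s; have [] := leP s (2 - s); lra.
Qed.

Lemma min2_ge s : Num.min 1 s - Num.max 0 (s - 1) <= Num.min s (2 - s).
Proof.
have [] := leP 0 (s - 1); have [] := leP 1 s; have [] := leP s (2 - s); lra.
Qed.

Lemma linear_level_le a b s d : 0 < d ->
  (hausdorff1_pre d (linear_level a b s) <= (linear_length a b s)%:E)%E.
Proof.
move=> d0; have d0' := ltW d0; have l0 := linear_length_ge0 a b s.
have [[p [/open_squareE[/andP[p1 p1'] /andP[p2 p2']] ab ps]]|S0] :=
  pselect (linear_level a b s !=set0); last first.
  by rewrite hausdorff1_pre_set0// => p Sp; apply: S0; exists p.
case: a b ab ps {l0} => [] [] // _; rewrite ?mul1r ?mul0r ?addr0 ?add0r => ps.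
- rewrite /linear_length/=; have s02 : 0 < Num.min s (2 - s) by rewrite lt_min; lra.
  rewrite max_r ?(ltW s02)//.
  have ab : Num.max 0 (s - 1) <= Num.min 1 s by have := min2_le s; lra.
  apply: (@le_trans _ _ (hausdorff1_pre d ((fun r => (r, s - r)) @`
    `[Num.max 0 (s - 1), Num.min 1 s]))).
    apply: le_hausdorff1_pre => -[u v] [/open_squareE/= [/andP[? ?] /andP[? ?]] _].
    rewrite !mul1r => uvs; exists u; last by congr pair; lra.
    by rewrite /= in_itv/= ge_max le_min; apply/andP; split; apply/andP; split; lra.
  apply: le_trans (hausdorff1_pre_segment_le d0 (ltW sqrt2_gt0) ab _) _.
    by move=> r r'; rewrite euclid_dist_antidiag.
  by rewrite lee_fin ler_pM2l ?sqrt2_gt0//; exact: min2_ge.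
- have sI : 0 < s < 1 by rewrite -ps; apply/andP.
  rewrite /linear_length/= indicE mem_set; last by rewrite /= in_itv.
  apply: (@le_trans _ _ (hausdorff1_pre d ((fun r => (s, r)) @` `[0, 1]))).
    apply: le_hausdorff1_pre => -[u v] [/open_squareE/= [/andP[? ?] /andP[? ?]] _].
    rewrite !mul1r mul0r addr0 => uvs; exists v; last by rewrite uvs.
    by rewrite /= in_itv/=; apply/andP; split; lra.
  apply: le_trans (hausdorff1_pre_segment_le d0 ler01 ler01 _) _.
    by move=> r r'; rewrite euclid_dist_vertical.
  by rewrite lee_fin mul1r subr0.
- have sI : 0 < s < 1 by rewrite -ps; apply/andP.
  rewrite /linear_length/= indicE mem_set; last by rewrite /= in_itv.
  apply: (@le_trans _ _ (hausdorff1_pre d ((fun r => (r, s)) @` `[0, 1]))).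
    apply: le_hausdorff1_pre => -[u v] [/open_squareE/= [/andP[? ?] /andP[? ?]] _].
    rewrite !mul1r mul0r add0r => uvs; exists u; last by rewrite uvs.
    by rewrite /= in_itv/=; apply/andP; split; lra.
  apply: le_trans (hausdorff1_pre_segment_le d0 ler01 ler01 _) _.
    by move=> r r'; rewrite euclid_dist_horizontal.
  by rewrite lee_fin mul1r subr0.
Qed.

Definition inner_box e : set (R * R) := `[e, 1 - e] `*` `[e, 1 - e].

(* [S] has length at least [r], already seen by covers at some positive scale
   and on a part of [S] away from the boundary of the unit square; this form
   is additive over the cells of a grid. *)
Definition has_length_ge S r := forall eta, 0 < eta ->
  exists2 e : R, 0 < e & ((r - eta)%:E <= hausdorff1_pre e (S `&` inner_box e))%E.

Lemma has_length_ge_anti S e e' : e' <= e ->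
  (hausdorff1_pre e (S `&` inner_box e) <= hausdorff1_pre e' (S `&` inner_box e'))%E.
Proof.
move=> ee'; apply: le_trans (hausdorff1_pre_anti _ ee') _.
apply: le_hausdorff1_pre => p [Sp [/=]]; rewrite !in_itv/= => /andP[? ?] /andP[? ?].
by split => //; split => /=; rewrite in_itv/=; apply/andP; split; lra.
Qed.

Lemma has_length_ge_le0 S r : r <= 0 -> has_length_ge S r.
Proof.
move=> r0 eta eta0; exists 1 => //; apply: le_trans (hausdorff1_pre_ge0 _ _).
by rewrite lee_fin; lra.
Qed.

Lemma hausdorff1_ge S r : has_length_ge S r -> (r%:E <= hausdorff1 S)%E.
Proof.
move=> Sr; apply/lee_addgt0Pr => eta eta0.
have [e e0 reta] := Sr _ eta0; rewrite -leeBlDr//.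
apply: le_trans reta _; apply: (@le_trans _ _ (hausdorff1_pre e S)).
  by apply: le_hausdorff1_pre => p [].
by apply: ereal_sup_ubound; exists e.
Qed.

Lemma linear_level_ge a b s : has_length_ge (linear_level a b s) (linear_length a b s).
Proof.
have [l0|l0] := leP (linear_length a b s) 0; first exact: has_length_ge_le0.
have sq2 : Num.sqrt 2 <= 2 :> R.
  by rewrite -[leRHS]ger0_norm// -sqrtr_sqr ler_wsqrtr//; lra.
move=> eta eta0; case: a b l0 => [] []; rewrite /linear_length/= ?ltxx//.
- rewrite pmulr_rgt0 ?sqrt2_gt0// lt_max ltxx/= => m0.
  rewrite max_r ?(ltW m0)//; have mle := min2_le s.
  set m := Num.min s (2 - s) in m0 mle *.
  set a := Num.max 0 (s - 1) in mle *; set b := Num.min 1 s in mle *.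
  (* Removing [e] at both ends of the parameter interval costs [2 * sqrt 2 * e <= 4 * e <= eta], and
     [e <= m / 4] keeps the interval nonempty. *)
  pose e := Num.min (m / 4) (eta / 4).
  have e0 : 0 < e by rewrite /e lt_min; apply/andP; split; lra.
  have em : e <= m / 4 by rewrite ge_min lexx.
  have eeta : e <= eta / 4 by rewrite ge_min lexx orbT.
  have [a0 as1] : 0 <= a /\ s - 1 <= a by split; rewrite /a le_max lexx ?orbT.
  have [b0 bs1] : b <= 1 /\ b <= s by split; rewrite /b ge_min lexx ?orbT.
  exists e => //.
  apply: (@le_trans _ _ (hausdorff1_pre e ((fun r => (r, s - r)) @`
    `[a + e, b - e]))); last first.
    apply: le_hausdorff1_pre => q [r /=]; rewrite in_itv/= => /andP[? ?] <-.
    split; last by split; rewrite /= in_itv/=; apply/andP; split; lra.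
    split => //=; first by split; rewrite /= in_itv/=; apply/andP; split; lra.
    by ring.
  apply: le_trans (hausdorff1_pre_segment_ge _ sqrt2_gt0 _ _).
  + by rewrite lee_fin; have := sqrt2_gt0; nra.
  + by lra.
  + by move=> r r'; rewrite euclid_dist_antidiag.
- rewrite indicE; case: (boolP (s \in _)) => [|_]; last by rewrite ltxx.
  rewrite inE/= in_itv/= => /andP[? ?] _.
  pose e := Num.min (Num.min s (1 - s)) (eta / 2).
  have e0 : 0 < e by rewrite /e !lt_min; apply/andP; split; [apply/andP; split|]; lra.
  have [es [es1 eeta]] : e <= s /\ e <= 1 - s /\ e <= eta / 2.
    by rewrite /e !ge_min !lexx ?orbT.
  exists e => //.
  apply: (@le_trans _ _ (hausdorff1_pre e ((fun r => (s, r)) @` `[e, 1 - e]))); last first.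
    apply: le_hausdorff1_pre => q [r /=]; rewrite in_itv/= => /andP[? ?] <-.
    split; last by split; rewrite /= in_itv/=; apply/andP; split; lra.
    split => //=; first by split; rewrite /= in_itv/=; apply/andP; split; lra.
    by ring.
  apply: le_trans (hausdorff1_pre_segment_ge _ ltr01 _ _).
  + by rewrite lee_fin; lra.
  + by lra.
  + by move=> r r'; rewrite euclid_dist_vertical.
- rewrite indicE; case: (boolP (s \in _)) => [|_]; last by rewrite ltxx.
  rewrite inE/= in_itv/= => /andP[? ?] _.
  pose e := Num.min (Num.min s (1 - s)) (eta / 2).
  have e0 : 0 < e by rewrite /e !lt_min; apply/andP; split; [apply/andP; split|]; lra.
  have [es [es1 eeta]] : e <= s /\ e <= 1 - s /\ e <= eta / 2.
    by rewrite /e !ge_min !lexx ?orbT.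
  exists e => //.
  apply: (@le_trans _ _ (hausdorff1_pre e ((fun r => (r, s)) @` `[e, 1 - e]))); last first.
    apply: le_hausdorff1_pre => q [r /=]; rewrite in_itv/= => /andP[? ?] <-.
    split; last by split; rewrite /= in_itv/=; apply/andP; split; lra.
    split => //=; first by split; rewrite /= in_itv/=; apply/andP; split; lra.
    by ring.
  apply: le_trans (hausdorff1_pre_segment_ge _ ltr01 _ _).
  + by rewrite lee_fin; lra.
  + by lra.
  + by move=> r r'; rewrite euclid_dist_horizontal.
Qed.

End level_pieces.

(** * Boundaries of upper level sets of a copula *)

Section level_boundary.
Context {R : realType} (A : copula R).
Implicit Types (s t d e r : R) (p q : R * R).

(** Continuity makes the upper set closed in the square, and by monotonicity it contains, with any
    point, all of the square above and to the right of it. A point of the open square is therefore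
    interior exactly when [A] is still at least [t] at some point diagonally below it. *)
Lemma level_boundaryP t p : level_boundary A t p <->
  [/\ open_square p, t <= A p.1 p.2 & forall e, 0 < e -> A (p.1 - e) (p.2 - e) < t].
Proof.
case: p => x y; split.
  move=> [[cU iU] xy]; split => //=.
    (* Raising both coordinates by [e] raises [A] by at most [2 * e], which is less than
       [t - A x y]. *)
    rewrite leNgt; apply/negP => Axy; pose e := (t - A x y) / 3.
    have e0 : 0 < e by rewrite /e; lra.
    have [[u v] [[_ /= tuv] [/= xu yv]]] := cU _ (nbhsx_ballx (x, y) e e0).
    have u1 : u <= x + e by move: xu; rewrite /ball /= ltr_norml => /andP[? ?]; lra.
    have v1 : v <= y + e by move: yv; rewrite /ball /= ltr_norml => /andP[? ?]; lra.
    have := copula_mono A u1 v1.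
    have := @copula_lip1 _ A x (x + e) (y + e).
    have := @copula_lip2 _ A x y (y + e).
    by rewrite !lerDl ltW// => /(_ isT) + /(_ isT); rewrite /e; lra.
  move=> e e0; rewrite ltNge; apply/negP => tA; apply: iU.
  have /open_squareE/= [/andP[? ?] /andP[? ?]] := xy.
  pose r := Num.min e (Num.min (Num.min x (1 - x)) (Num.min y (1 - y))).
  have r0 : 0 < r by rewrite /r !lt_min e0 /=; apply/andP; split; apply/andP; split; lra.
  have [? [? [? [? ?]]]] : r <= e /\ r <= x /\ r <= 1 - x /\ r <= y /\ r <= 1 - y.
    by rewrite /r !ge_min !lexx ?orbT.
  apply/nbhs_ballP; exists r => //= -[u v] [/=].
  rewrite /ball /= !ltr_norml => /andP[? ?] /andP[? ?].
  split; first by split; rewrite /I01 /= in_itv/=; apply/andP; split; lra.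
  by apply: le_trans tA _; apply: copula_mono => /=; lra.
move=> [/= xy tA Alt]; split => //; split.
  apply: subset_closure; split => //=.
  have /open_squareE/= [/andP[? ?] /andP[? ?]] := xy.
  by split; rewrite /I01 /= in_itv/=; apply/andP; split; lra.
move=> /nbhs_ballP[r /= r0 rU].
have r20 : 0 < r / 2 by rewrite divr_gt0.
have := Alt _ r20; rewrite ltNge => /negP; apply.
have [] // : upper_set A t (x - r / 2, y - r / 2).
apply: rU; split; rewrite /ball /= opprB addrCA subrr addr0 gtr0_norm//.
  by rewrite ltr_pdivrMr// mulr_natr mulr2n ltrDl.
by rewrite ltr_pdivrMr// mulr_natr mulr2n ltrDl.
Qed.

Lemma level_boundary_eq t p : level_boundary A t p -> A p.1 p.2 = t.
Proof.
move=> /level_boundaryP[_ tA Alt]; apply/eqP; rewrite eq_le tA andbT.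
apply/ler_addgt0Pr => e e0; have e20 : 0 < e / 2 by rewrite divr_gt0.
have := Alt _ e20.
have := @copula_lip1 _ A (p.1 - e / 2) p.1 p.2.
have := @copula_lip2 _ A (p.1 - e / 2) (p.2 - e / 2) p.2.
by rewrite !gerBl ltW// => /(_ isT) + /(_ isT); lra.
Qed.

Lemma level_boundary_out t p : level_boundary A t p -> 0 < t < 1.
Proof.
move=> /[dup] /level_boundaryP[/open_squareE[/andP[? ?] /andP[? ?]] _ Alt] /level_boundary_eq tE.
rewrite -{2}tE (le_lt_trans (copula_ge0 A (p.1 - 1) (p.2 - 1)))/= ?Alt//.
have : A p.1 p.2 <= A p.1 1 by apply: copula_mono; rewrite // ltW.
rewrite (@copula_ge1r _ A p.1 1)// clamp_id; last by apply/andP; split; lra.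
by rewrite tE; lra.
Qed.

End level_boundary.

(** * Self-similarity of the level curves *)

Section self_similar_levels.
Context {R : realType} (N : nat) (pi : 'S_N) (N_gt1 : (2 <= N)%N) (A : copula R).
Hypothesis hA : eq_on_square (joint_cdf (Vop pi (copula_measure A))) A.
Implicit Types (s t d e u v : R) (p q : R * R) (j k : 'I_N) (c : 'I_N * 'I_N).

Let N_gt0 : 0 < N%:R :> R.
Proof. by rewrite ltr0n ltnW. Qed.

Let Ni_gt0 : 0 < N%:R^-1 :> R.
Proof. by rewrite invr_gt0. Qed.

Let ler_ordS j : j%:R + 1 <= N%:R :> R.
Proof. by rewrite natr1 ler_nat. Qed.

Lemma copula_cell j k u v : 0 <= u <= 1 -> 0 <= v <= 1 ->
  A ((j%:R + u) / N%:R) ((k%:R + v) / N%:R) =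
  N%:R^-1 * ((cell_base pi j k)%:R + (slope1 pi j k)%:R * u
    + (slope2 pi j k)%:R * v + (pi k == j)%:R * A u v).
Proof.
move=> uI vI; rewrite -joint_cdf_Vop_cell// hA//; rewrite /I01 /= in_itv/=.
  move: uI => /andP[? ?]; rewrite divr_ge0 ?addr_ge0// ler_pdivrMr//.
  by have := ler_ordS j; lra.
move: vI => /andP[? ?]; rewrite divr_ge0 ?addr_ge0// ler_pdivrMr//.
by have := ler_ordS k; lra.
Qed.

Lemma slope_diag j k : pi k = j ->
  (slope1 pi j k = false) * (slope2 pi j k = false).
Proof. by move=> <-; rewrite /slope1 /slope2 permK !ltnn. Qed.

Definition cell_piece c s : set (R * R) :=
  if pi c.2 == c.1 then level_boundary A s
  else linear_level (slope1 pi c.1 c.2) (slope2 pi c.1 c.2) s.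

Definition cell_level c t : R := N%:R * t - (cell_base pi c.1 c.2)%:R.

(** Both conditions of [level_boundaryP] can be tested inside one cell, where [N * A] is [cell_base]
    plus the function [L] of the cell coordinates. *)
Lemma level_boundary_cell t c q : open_square q ->
  level_boundary A t (cell_map c.1 c.2 q) <-> cell_piece c (cell_level c t) q.
Proof.
case: c => j k; case: q => u v oq.
have /open_squareE/= [/andP[u0 u1] /andP[v0 v1]] := oq.
set s := cell_level _ t.
pose L u v := (slope1 pi j k)%:R * u + (slope2 pi j k)%:R * v + (pi k == j)%:R * A u v.
have ALs u' v' : 0 <= u' <= 1 -> 0 <= v' <= 1 ->
    (A ((j%:R + u') / N%:R) ((k%:R + v') / N%:R) < t) = (L u' v' < s).
  move=> uI vI; rewrite copula_cell// -!addrA -/(L _ _).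
  by rewrite [_ * (_ + _)]mulrC ltr_pdivrMr// /s /cell_level/= ltrBrDl [t * _]mulrC addrA.
have Lmono u1' v1' u2' v2' : u1' <= u2' -> v1' <= v2' -> L u1' v1' <= L u2' v2'.
  by move=> uu vv; rewrite /L lerD ?lerD ?ler_wpM2l// copula_mono.
have step1 : level_boundary A t (cell_map j k (u, v)) <->
    s <= L u v /\ forall e, 0 < e -> L (u - e) (v - e) < s.
  rewrite level_boundaryP /cell_map /=; split.
    move=> [_ tA Alt]; split.
      by rewrite leNgt -ALs ?(ltW u0) ?(ltW v0) ?ltW// -leNgt.
    (* The step is shortened so as to stay in the cell; by monotonicity a longer step only lowers
       the value further. *)
    move=> e e0; pose e' := Num.min e (Num.min u v).
    have e'0 : 0 < e' by rewrite /e' !lt_min e0 u0 v0.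
    have [? [? ?]] : e' <= e /\ e' <= u /\ e' <= v by rewrite /e' !ge_min !lexx ?orbT.
    apply: le_lt_trans (Lmono _ _ (u - e') (v - e') _ _) _; [lra|lra|].
    rewrite -ALs; [|apply/andP; split; lra|apply/andP; split; lra].
    have := Alt _ (mulr_gt0 e'0 Ni_gt0).
    by rewrite -!mulrBl -!addrA.
  move=> [sL Llt]; split.
  - split; rewrite /= in_itv/= divr_gt0 ?ltr_wpDl//= ltr_pdivrMr// mul1r.
      by have := ler_ordS j; lra.
    by have := ler_ordS k; lra.
  - by rewrite leNgt ALs ?(ltW u0) ?(ltW v0) ?ltW// -leNgt.
  - move=> e e0; pose e' := Num.min (N%:R * e) (Num.min u v).
    have e'0 : 0 < e' by rewrite /e' !lt_min mulr_gt0// u0 v0.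
    have [e'e [? ?]] : e' <= N%:R * e /\ e' <= u /\ e' <= v.
      by rewrite /e' !ge_min !lexx ?orbT.
    have {}e'e : e' / N%:R <= e by rewrite ler_pdivrMr// mulrC.
    apply: (@le_lt_trans _ _ (A ((j%:R + (u - e')) / N%:R) ((k%:R + (v - e')) / N%:R))).
      by apply: copula_mono; rewrite addrA mulrBl lerD2l lerN2.
    by rewrite ALs ?Llt//; apply/andP; split; lra.
rewrite step1 /cell_piece/=; case: ifPn => [/eqP kj|kj].
  have LA u' v' : L u' v' = A u' v'.
    by rewrite /L !(slope_diag kj) kj eqxx !mul0r mul1r !add0r.
  rewrite level_boundaryP/= LA; split => [[? Llt]|[_ ? Alt]]; split => // e e0.
    by rewrite -LA Llt.
  by rewrite LA Alt.
have LE u' v' : L u' v' = (slope1 pi j k)%:R * u' + (slope2 pi j k)%:R * v'.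
  by rewrite /L (negbTE kj) mul0r addr0.
rewrite /linear_level /= -LE; split => [[sL Llt]|[_ ab Ls]].
  split => //.
    have := Llt _ ltr01; move: sL; rewrite !LE.
    by case: slope1; case: slope2; rewrite ?orbT// !mul0r; lra.
  apply/eqP; rewrite eq_le sL andbT; apply/ler_addgt0Pr => e e0.
  have e20 : 0 < e / 2 by rewrite divr_gt0.
  have := Llt _ e20; rewrite !LE.
  by case: slope1; case: slope2; rewrite ?mul1r ?mul0r; lra.
rewrite Ls lexx; split => // e e0; rewrite -Ls !LE; move: ab.
by case: slope1; case: slope2; rewrite // ?mul1r ?mul0r; lra.
Qed.

(* If [phi t] is the length of the level curve at [t], then so is
   [length_op phi t], except possibly for N-adic [t], where a level set may
   contain a segment of a grid line. *)
Definition length_op (phi : R -> R) t : R :=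
  N%:R^-1 * \sum_(c : 'I_N * 'I_N)
    (if pi c.2 == c.1 then phi (cell_level c t)
     else linear_length (slope1 pi c.1 c.2) (slope2 pi c.1 c.2) (cell_level c t)).

Lemma exists_cell_coord u : 0 <= u < 1 ->
  exists (j : 'I_N) (v : R), 0 <= v < 1 /\ u = (j%:R + v) / N%:R.
Proof.
move=> /andP[u0 u1].
have /andP[nu un] := Num.Theory.truncn_itv (mulr_ge0 (ltW N_gt0) u0).
have jN : (Num.truncn (N%:R * u) < N)%N.
  rewrite -(ltr_nat R); apply: le_lt_trans nu _.
  by rewrite -[ltRHS]mulr1 ltr_pM2l.
exists (Ordinal jN), (N%:R * u - (Num.truncn (N%:R * u))%:R).
rewrite subr_ge0 nu; split; first by rewrite ltrBlDl natr1.
by rewrite /= subrKC mulrC mulKf// gt_eqF.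
Qed.

Definition Nadic t : Prop := exists n m : nat, t * N%:R ^+ n = m%:R.

Lemma Nadic_cell c t : Nadic (cell_level c t) -> Nadic t.
Proof.
move=> [n [m nm]]; exists n.+1, (m + cell_base pi c.1 c.2 * N ^ n)%N.
by rewrite natrD natrM natrX -nm /cell_level exprS; ring.
Qed.

Lemma hausdorff1_pre_cell_le d c S : 0 < d ->
  (hausdorff1_pre d (cell_map c.1 c.2 @` S)
    <= (N%:R^-1)%:E * hausdorff1_pre (N%:R * d) S)%E.
Proof.
move=> d0; have := @hausdorff1_pre_lipschitz R (N%:R * d) N%:R^-1 (cell_map c.1 c.2) S.
rewrite mulrA mulVf ?gt_eqF// mul1r; apply => // p q _ _.
rewrite -(euclid_dist_scale (c.1%:R / N%:R) (c.2%:R / N%:R) p q (ltW Ni_gt0)).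
rewrite le_eqVlt; apply/orP; left; apply/eqP.
by congr euclid_dist; rewrite /cell_map; congr pair; ring.
Qed.

Lemma hausdorff1_pre_cell_ge d c S :
  ((N%:R^-1)%:E * hausdorff1_pre (N%:R * d) S
    <= hausdorff1_pre d (cell_map c.1 c.2 @` S))%E.
Proof.
rewrite lee_pdivrMl//.
pose g p : R * R := (N%:R * p.1 - c.1%:R, N%:R * p.2 - c.2%:R).
have gK p : g (cell_map c.1 c.2 p) = p.
  by case: p => u v; rewrite /g /cell_map /=; congr pair; field; rewrite gt_eqF.
rewrite -[X in (hausdorff1_pre _ X <= _)%E](_ : g @` (cell_map c.1 c.2 @` S) = S).
  apply: hausdorff1_pre_lipschitz => // p q _ _.
  by rewrite -(euclid_dist_scale (- c.1%:R) (- c.2%:R) p q (ltW N_gt0)).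
apply/seteqP; split => [_ [_ [p Sp <-] <-]|p Sp]; first by rewrite gK.
by exists (cell_map c.1 c.2 p); rewrite ?gK//; exists p.
Qed.

(** Passing to a cell multiplies the scale [d] by [N] in cell coordinates. After [n] passages it is
    at least the diameter [sqrt 2] of the unit square, and a level curve may serve as its own cover.
    The levels met on the way stay non-N-adic by [Nadic_cell]. *)
Lemma hausdorff1_pre_level_le n d t : 0 < d -> Num.sqrt 2 <= N%:R ^+ n * d ->
  ~ Nadic t ->
  (hausdorff1_pre d (level_boundary A t) <=
   (iter n length_op (fun s => Num.sqrt 2 * \1_(`]0, 1[%classic) s) t)%:E)%E.
Proof.
elim: n d t => [|n ih] d t d0 dn tN /=.
  rewrite expr0 mul1r in dn; rewrite indicE.
  have diam : (euclid_diam (level_boundary A t) <= (Num.sqrt 2)%:E)%E.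
    apply: euclid_diam_le; first by rewrite lee_fin sqrtr_ge0.
    move=> p q /level_boundaryP[/open_squareE[/andP[? ?] /andP[? ?]] _ _].
    move=> /level_boundaryP[/open_squareE[/andP[? ?] /andP[? ?]] _ _].
    by rewrite lee_fin euclid_dist_square// ltW//= ltW.
  have [t01|t01] := boolP (t \in _).
    rewrite mulr1; apply: (le_trans _ diam).
    by apply: hausdorff1_pre_le_diam; [exact: ltW|apply: le_trans diam _].
  rewrite hausdorff1_pre_set0 ?mulr0// ?ltW// => p /level_boundary_out t1.
  by move: t01; rewrite notin_setE /= in_itv/= t1.
(* Half-open cells cover the open square, and grid lines enter only as the left edge [E1] and the
   lower edge [E2] of a cell. *)
pose F c := level_boundary A t `&`
  [set p | exists u v, [/\ 0 <= u < 1, 0 <= v < 1 & p = cell_map c.1 c.2 (u, v)]].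
apply: (@le_trans _ _ (\sum_c hausdorff1_pre d (F c))%E).
  apply: hausdorff1_pre_le_sum; first exact: ltW.
  move=> [x y] /[dup] Gp /level_boundaryP[/open_squareE/= [/andP[? ?] /andP[? ?]] _ _].
  have [|j [u [uI xE]]] := @exists_cell_coord x; first by apply/andP; split; lra.
  have [|k [v [vI yE]]] := @exists_cell_coord y; first by apply/andP; split; lra.
  by exists (j, k); split => //; exists u, v; split => //; rewrite /cell_map/= xE yE.
rewrite /length_op mulr_sumr -sumEFin; apply: lee_sum => c _; rewrite EFinM.
set s := cell_level c t.
have sN : ~ Nadic s by move=> /Nadic_cell.
pose E1 := F c `&` [set p | p.1 = c.1%:R / N%:R].
pose E2 := F c `&` [set p | p.2 = c.2%:R / N%:R].
have NtN (m : nat) : N%:R * t != m%:R.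
  by apply/eqP => tm; apply: tN; exists 1%N, m; rewrite expr1 mulrC.
have NA u v : 0 <= u < 1 -> 0 <= v < 1 ->
    level_boundary A t (cell_map c.1 c.2 (u, v)) ->
    N%:R * t = (cell_base pi c.1 c.2)%:R + (slope1 pi c.1 c.2)%:R * u
      + (slope2 pi c.1 c.2)%:R * v + (pi c.2 == c.1)%:R * A u v.
  move=> /andP[? ?] /andP[? ?] /level_boundary_eq <-; rewrite /cell_map /= copula_cell.
  - by rewrite mulVKf// gt_eqF.
  - by apply/andP; split; lra.
  - by apply/andP; split; lra.
(* On the left edge [u = 0] the term [A u v] vanishes, so [N * t] is an integer or an integer plus
   [v]. The first is excluded since [t] is not N-adic; the second determines [v], leaving at most
   one point. *)
have H1 : hausdorff1_pre d E1 = 0%E.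
  apply: hausdorff1_pre_subsingleton; first exact: ltW.
  move=> p q [[Gp [u [v [uI vI pE]]]] p1] [[Gq [u' [v' [uI' vI' qE]]]] q1].
  have z (w : R) : (c.1%:R + w) / N%:R = c.1%:R / N%:R -> w = 0.
    by move=> /(mulIf (lt0r_neq0 Ni_gt0)); lra.
  have u0 : u = 0 by apply: z; move: p1; rewrite pE.
  have u'0 : u' = 0 by apply: z; move: q1; rewrite qE.
  have := NA u v uI vI; have := NA u' v' uI' vI'.
  rewrite -pE -qE => /(_ Gq) + /(_ Gp); rewrite u0 u'0 !mulr0 !addr0.
  rewrite !copula_le0l// !mulr0 !addr0.
  case: slope2; last by rewrite !mul0r addr0 => /eqP; rewrite (negbTE (NtN _)).
  by rewrite pE qE u0 u'0 !mul1r => -> ?; congr (cell_map _ _ (_, _)); lra.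
have H2 : hausdorff1_pre d E2 = 0%E.
  apply: hausdorff1_pre_subsingleton; first exact: ltW.
  move=> p q [[Gp [u [v [uI vI pE]]]] p1] [[Gq [u' [v' [uI' vI' qE]]]] q1].
  have z (w : R) : (c.2%:R + w) / N%:R = c.2%:R / N%:R -> w = 0.
    by move=> /(mulIf (lt0r_neq0 Ni_gt0)); lra.
  have v0 : v = 0 by apply: z; move: p1; rewrite pE.
  have v'0 : v' = 0 by apply: z; move: q1; rewrite qE.
  have := NA u v uI vI; have := NA u' v' uI' vI'.
  rewrite -pE -qE => /(_ Gq) + /(_ Gp); rewrite v0 v'0 !mulr0 !addr0.
  rewrite !copula_le0r// !mulr0 !addr0.
  case: slope1; last by rewrite !mul0r addr0 => /eqP; rewrite (negbTE (NtN _)).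
  by rewrite pE qE v0 v'0 !mul1r => -> ?; congr (cell_map _ _ (_, _)); lra.
apply: (@le_trans _ _ (hausdorff1_pre d
    ((cell_map c.1 c.2 @` cell_piece c s) `|` (E1 `|` E2)))).
  apply: le_hausdorff1_pre => p [Gp [u [v [/andP[u0 u1] /andP[v0 v1] pE]]]].
  have [u00|u00] := eqVneq u 0.
    right; left; split; first by split => //; exists u, v; rewrite u0 v0.
    by rewrite /= pE /cell_map/= u00 addr0.
  have [v00|v00] := eqVneq v 0.
    right; right; split; first by split => //; exists u, v; rewrite u0 v0.
    by rewrite /= pE /cell_map/= v00 addr0.
  left; exists (u, v) => //; rewrite -level_boundary_cell -?pE//.
  by split; rewrite /= in_itv/= lt_neqAle eq_sym ?u00 ?v00 ?u0 ?v0.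
apply: le_trans (hausdorff1_preU _ _ (ltW d0)) _.
rewrite -[leRHS]adde0; apply: leeD; last first.
  by apply: le_trans (hausdorff1_preU _ _ (ltW d0)) _; rewrite H1 H2 adde0.
apply: le_trans (hausdorff1_pre_cell_le _ _ d0) _.
rewrite lee_pmul2l//= /cell_piece; case: ifPn => _.
  by apply: ih => //; rewrite ?mulr_gt0// mulrA -exprSr.
by apply: linear_level_le; rewrite mulr_gt0.
Qed.

(** Restricting each piece to [inner_box e0] leaves a gap of at least [2 * e0 / N] between pieces in
    different cells, so the bounds at scale [e0 / N] add up. Every [t] is allowed: segments on grid
    lines can only add length. *)
Lemma level_boundary_length_ge n t :
  has_length_ge (level_boundary A t) (iter n length_op (fun=> 0) t).
Proof.
elim: n t => [|n ih] t; first exact: has_length_ge_le0.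
set r := iter n length_op _ in ih.
have piece c : has_length_ge (cell_piece c (cell_level c t))
    (if pi c.2 == c.1 then r (cell_level c t)
     else linear_length (slope1 pi c.1 c.2) (slope2 pi c.1 c.2) (cell_level c t)).
  by rewrite /cell_piece; case: ifP => // _; exact: linear_level_ge.
(* Each of the [N ^ 2] cells loses [eta' / N], in total [eta]. *)
move=> eta eta0; pose eta' := eta / N%:R.
have eta'0 : 0 < eta' by rewrite divr_gt0.
have /choice[e eP] : forall c, exists e : R, 0 < e /\
    (((if pi c.2 == c.1 then r (cell_level c t)
     else linear_length (slope1 pi c.1 c.2) (slope2 pi c.1 c.2) (cell_level c t)) - eta')%:E
     <= hausdorff1_pre e (cell_piece c (cell_level c t) `&` inner_box e))%E.
  by move=> c; have [e ? ?] := piece c _ eta'0; exists e.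
pose e0 := \big[Num.min/1]_c e c.
have e00 : 0 < e0 by apply/bigmin_gtP; split => // c _; have [] := eP c.
have e0e c : e0 <= e c by exact: bigmin_le.
pose K c := cell_map c.1 c.2 @` (cell_piece c (cell_level c t) `&` inner_box e0).
exists (e0 / N%:R); first by rewrite divr_gt0.
apply: (@le_trans _ _ (\sum_c hausdorff1_pre (e0 / N%:R) (K c))%E); last first.
  apply: hausdorff1_pre_separated.
    move=> [j k] p [[u v] [piecep [/=]]].
    rewrite !in_itv/= => /andP[? ?] /andP[? ?] <-; split.
      apply/(@level_boundary_cell t (j, k)) => //.
      by split; rewrite /= in_itv/=; apply/andP; split; lra.
    have j0 : 0 <= j%:R :> R by []. have k0 : 0 <= k%:R :> R by [].
    have := ler_ordS j; have := ler_ordS k => ? ?.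
    have NN : N%:R^-1 * N%:R = 1 :> R by rewrite mulVf ?gt_eqF.
    by split; rewrite /= /cell_map /= in_itv/= ler_pM2r// lerBrDr -mulrDl ler_pdivrMr// mul1r;
      apply/andP; split; lra.
  move=> [j k] [j' k'] p q jk [[u v] [_ [/=]]] + + <- [[u' v'] [_ [/=]]] + + <-.
  rewrite !in_itv/= => /andP[? ?] /andP[? ?] /andP[? ?] /andP[? ?].
  have sep (a b : 'I_N) (x y : R) : a != b -> e0 <= x <= 1 - e0 -> e0 <= y <= 1 - e0 ->
      e0 / N%:R < `|(a%:R + x) / N%:R - (b%:R + y) / N%:R|.
    move=> ab /andP[? ?] /andP[? ?].
    rewrite -mulrBl normrM [`|N%:R^-1|]gtr0_norm// ltr_pM2r//.
    have lt_sep (m m' : nat) (x' y' : R) : (m < m')%N ->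
        e0 <= y' -> x' <= 1 - e0 -> e0 < m'%:R + y' - (m%:R + x').
      move=> mn ? ?; have : m.+1%:R <= m'%:R :> R by rewrite ler_nat.
      by rewrite -natr1; lra.
    have [mn|mn] : (a < b)%N \/ (b < a)%N by apply/orP; rewrite -neq_ltn.
      rewrite distrC; apply: (lt_le_trans _ (ler_norm _)).
      by apply: lt_sep.
    by apply: (lt_le_trans _ (ler_norm _)); apply: lt_sep.
  have [jj'|jj'] := eqVneq j j'.
    have kk' : k != k' by apply: contraNneq jk => ->; rewrite jj'.
    apply: (lt_le_trans _ (le_euclid_dist2 _ _)); apply: sep => //=; apply/andP; split; lra.
  apply: (lt_le_trans _ (le_euclid_dist1 _ _)); apply: sep => //=; apply/andP; split; lra.
apply: (@le_trans _ _ (\sum_(c : 'I_N * 'I_N) (N%:R^-1)%:E *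
  ((if pi c.2 == c.1 then r (cell_level c t)
     else linear_length (slope1 pi c.1 c.2) (slope2 pi c.1 c.2) (cell_level c t)) - eta')%:E)%E).
  under eq_bigr do rewrite -EFinM; rewrite sumEFin lee_fin -mulr_sumr sumrB.
  rewrite [in leRHS]mulrBr lerB//.
  rewrite sumr_const card_prod card_ord -[eta' *+ _]mulr_natl natrM /eta'.
  rewrite (_ : N%:R^-1 * (N%:R * N%:R * (eta / N%:R)) = eta)//.
  by field; rewrite gt_eqF.
apply: lee_sum => c _; apply: le_trans (hausdorff1_pre_cell_ge _ _ _).
rewrite lee_pmul2l// (_ : N%:R * (e0 / N%:R) = e0); last by rewrite mulrC divfK ?gt_eqF.
by have [_] := eP c; move/le_trans; apply; exact: has_length_ge_anti.
Qed.

End self_similar_levels.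

(** * Counting cells *)

Section counting.
Context {R : realType} (N : nat) (pi : 'S_N) (N_gt1 : (2 <= N)%N).
Implicit Types (c : 'I_N * 'I_N).

Definition weight (w11 w10 w00 : R) (a b : bool) : R :=
  if a && b then w11 else if a || b then w10 else w00.

(** Cells are indexed by (column, row), the members of [dominated_pairs] by (row, column). *)
Let transpose c : 'I_N * 'I_N := (c.2, c.1).

Let transposeK : involutive transpose.
Proof. by case. Qed.

Let flip c : 'I_N * 'I_N := (pi c.2, (pi^-1)%g c.1).

Let flipK : involutive flip.
Proof. by case=> j k; rewrite /flip /= permK permKV. Qed.

Lemma sum_dominated : (#|dominated_pairs pi|)%:R =
  \sum_c (slope1 pi c.1 c.2 && slope2 pi c.1 c.2)%:R :> R.
Proof.
rewrite -sum1_card natr_sum (reindex_inj (inv_inj transposeK)) big_mkcond/=.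
apply: eq_bigr => -[j k] _; rewrite inE /slope1 /slope2 /= andbC.
by case: ifP.
Qed.

(** Under [flip] the conditions [pi^-1 j < k] and [pi k < j] become their strict reversals. Equality
    in either comparison means [pi k = j], which explains the extra clause. *)
Lemma sum_codominated : (#|dominated_pairs pi|)%:R =
  \sum_c ([&& pi c.2 != c.1, ~~ slope1 pi c.1 c.2 & ~~ slope2 pi c.1 c.2])%:R :> R.
Proof.
rewrite sum_dominated (reindex_inj (inv_inj flipK))/=; apply: eq_bigr => -[j k] _.
rewrite /slope1 /slope2 /= permK permKV -!leqNgt !ltn_neqAle.
congr ((nat_of_bool _)%:R); rewrite andbACA; congr (_ && _).
have -> : (k == (pi^-1)%g j :> nat) = (pi k == j).
  by apply/eqP/eqP => [/val_inj ->|<-]; rewrite ?permKV ?permK.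
have -> : (j == pi k :> nat) = (pi k == j) by rewrite eq_sym.
by rewrite andbb.
Qed.

(** Of the [N * (N - 1)] cells off the graph of [pi], as many have two slopes 1 as have none, namely
    the number of dominated pairs; all others have weight [w10]. *)
Lemma sum_weight (w11 w10 w00 m : R) :
  \sum_c (if pi c.2 == c.1 then m
    else weight w11 w10 w00 (slope1 pi c.1 c.2) (slope2 pi c.1 c.2)) =
  N%:R * m + N%:R * (N%:R - 1) * w10
  + (w11 + w00 - 2 * w10) * (#|dominated_pairs pi|)%:R.
Proof.
have diag : \sum_c (pi c.2 == c.1)%:R = N%:R :> R.
  rewrite -(pair_bigA _ (fun j k => (pi k == j)%:R)) /= exchange_big/=.
  rewrite (eq_bigr (fun=> 1)); last first.
    move=> k _; rewrite (bigD1 (pi k))//= eqxx big1 ?addr0// => j jk.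
    by rewrite eq_sym (negbTE jk).
  by rewrite sumr_const card_ord.
rewrite mulrDl -[_ * #|_|%:R]addr0.
transitivity (\sum_c ((m - w10) * (pi c.2 == c.1)%:R + w10
   + (w11 - w10) * (slope1 pi c.1 c.2 && slope2 pi c.1 c.2)%:R
   + (w00 - w10) * [&& pi c.2 != c.1, ~~ slope1 pi c.1 c.2 & ~~ slope2 pi c.1 c.2]%:R)).
  apply: eq_bigr => -[j k] _ /=; case: eqP => [/slope_diag sd|_].
    by rewrite !sd/=; ring.
  by rewrite /weight; case: slope1; case: slope2 => /=; ring.
rewrite !big_split/= -!mulr_sumr diag -sum_dominated -sum_codominated.
rewrite sumr_const card_prod card_ord -[w10 *+ _]mulr_natl natrM; ring.
Qed.

End counting.

(** * Affine recurrences *)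

Section affine_recurrence.
Context {R : realType}.

(** The deviation from the fixed point [l] shrinks by the factor 1/N at each step, whatever the
    starting value. *)
Lemma cvg_affine_recurrence (N : nat) (C : R) (u : nat -> R) : (2 <= N)%N ->
  (forall n, u n.+1 = C + N%:R^-1 * u n) ->
  u @ \oo --> C * (N%:R / (N%:R - 1)).
Proof.
move=> N1 uS; pose l := C * (N%:R / (N%:R - 1)).
have N2 : 2 <= N%:R :> R by rewrite ler_nat.
have uE n : u n = l + (u 0%N - l) * N%:R^-1 ^+ n.
  elim: n => [|n ih]; first by rewrite expr0; ring.
  rewrite uS ih exprS /l; field; apply/andP; split; apply: lt0r_neq0; lra.
rewrite (_ : u = fun n => l + (u 0%N - l) * N%:R^-1 ^+ n); last exact/funext.
rewrite -[X in _ --> X]addr0 -/l; apply: cvgD; first exact: cvg_cst.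
rewrite -(mulr0 (u 0%N - l)); apply: cvgM; first exact: cvg_cst.
apply: cvg_expr; rewrite gtr0_norm ?invr_gt0; last lra.
by rewrite invf_lt1; lra.
Qed.

End affine_recurrence.

(** * The length measure *)

Section length_integral.
Context {R : realType}.
Local Notation lambda := (@lebesgue_measure R).

Lemma measurable_linear_length a b : measurable_fun setT (linear_length a b : R -> R).
Proof.
rewrite /linear_length; case: (a && b).
  apply: measurable_funM => //; apply: measurable_maxr => //.
  by apply: measurable_minr => //; apply: measurable_funB.
by case: (a || b) => //; apply: measurable_indic; exact: measurable_itv.
Qed.

Lemma lebesgue_measure_unit_itv b1 b2 :
  lambda [set` Interval (BSide b1 0) (BSide b2 1)] = 1%E.
Proof. by rewrite lebesgue_measure_itv/= lte_fin ltr01 -EFinB subr0. Qed.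

(** The falling half [g2], translated by 1, complements the rising half [g1] to the indicator of
    []0, 1]]. *)
Lemma integral_tent :
  (\int[lambda]_s (Num.max 0 (Num.min s (2 - s)))%:E = 1)%E.
Proof.
pose g1 (s : R) : R := s * \1_(`]0, 1]%classic) s.
pose g2 (s : R) : R := (2 - s) * \1_(`]1, 2]%classic) s.
have mg1 : measurable_fun setT g1 by apply: measurable_funM.
have mg2 : measurable_fun setT g2.
  by apply: measurable_funM => //; apply: measurable_funB.
have g10 s : 0 <= g1 s.
  rewrite /g1 indicE; case: (boolP (s \in _)); rewrite ?mulr0// inE/= in_itv/=.
  by move=> /andP[/ltW]; rewrite mulr1.
have g20 s : 0 <= g2 s.
  rewrite /g2 indicE; case: (boolP (s \in _)); rewrite ?mulr0// inE/= in_itv/=.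
  by move=> /andP[? ?]; rewrite mulr1 subr_ge0.
transitivity (\int[lambda]_s ((g1 s)%:E + (g2 s)%:E))%E.
  apply: eq_integral => s _; rewrite -EFinD; congr EFin; rewrite /g1 /g2 !indicE.
  have [s0|s0] := leP s 0.
    rewrite !memNset ?mulr0 ?addr0/= ?in_itv/=.
    - by rewrite max_l// ge_min s0.
    - by apply/negP; rewrite negb_and -!leNgt; apply/orP; left; lra.
    - by apply/negP; rewrite negb_and -!leNgt; apply/orP; left; lra.
  have [s1|s1] := leP s 1.
    rewrite mem_set ?memNset/= ?in_itv/= ?s0 ?s1//; last first.
      by apply/negP; rewrite negb_and -!leNgt s1.
    by rewrite mulr0 addr0 mulr1 min_l ?max_r; lra.
  rewrite memNset/= ?in_itv/=; last by apply/negP; rewrite negb_and -!leNgt -!ltNge s1 orbT.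
  have [s2|s2] := leP s 2.
    rewrite mem_set/= ?in_itv/= ?s1//.
    by rewrite mulr0 add0r mulr1 min_r ?max_r; lra.
  rewrite memNset/= ?in_itv/=; last by apply/negP; rewrite negb_and -!leNgt -!ltNge s2 orbT.
  by rewrite !mulr0 addr0 min_r ?max_l; lra.
rewrite ge0_integralD//; [|by move=> s _; rewrite lee_fin|exact/measurable_EFinP
  |by move=> s _; rewrite lee_fin|exact/measurable_EFinP].
have := @ge0_integral_affine _ 1 1 (EFin \o g2) ltr01.
rewrite invr1 mul1e => <-; [|exact/measurable_EFinP|by move=> s; rewrite lee_fin].
rewrite -ge0_integralD//; last 4 first.
- by move=> s _; rewrite lee_fin.
- exact/measurable_EFinP.
- by move=> s _; rewrite lee_fin.
- apply/measurable_EFinP; apply: (measurableT_comp mg2).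
  by apply: measurable_funD => //; apply: measurable_funM.
transitivity (\int[lambda]_s (\1_(`]0, 1]%classic) s)%:E)%E; last first.
  by rewrite integral_indic// setIT; exact: lebesgue_measure_unit_itv.
apply: eq_integral => s _; rewrite /= -EFinD; congr EFin; rewrite /g1 /g2 !indicE.
have -> : (1 * s + 1 \in `]1, 2]%classic) = (s \in `]0, 1]%classic).
  apply/idP/idP; rewrite !inE/= !in_itv/= => /andP[? ?]; apply/andP; split; lra.
by case: (s \in _) => /=; ring.
Qed.

Lemma integral_linear_length a b :
  (\int[lambda]_s (linear_length a b s)%:E = (weight (Num.sqrt 2) 1 0 a b)%:E)%E.
Proof.
rewrite /linear_length /weight; case: (a && b).
  pose tent (s : R) : R := Num.max 0 (Num.min s (2 - s)).
  have mt : measurable_fun setT tent.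
    by apply: measurable_maxr => //; apply: measurable_minr => //; apply: measurable_funB.
  rewrite (_ : (fun s => _) = (fun s => (Num.sqrt 2)%:E * (tent s)%:E)%E); last first.
    by apply/funext => s; rewrite -EFinM.
  rewrite ge0_integralZl//; last 2 first.
  - exact/measurable_EFinP.
  - by move=> s _; rewrite lee_fin le_max lexx.
  by rewrite integral_tent mule1.
case: (a || b); last exact: integral0.
by rewrite integral_indic// setIT; exact: lebesgue_measure_unit_itv.
Qed.

End length_integral.

(** * Integration of the length over all levels *)

Section length_measure.
Context {R : realType} (N : nat) (pi : 'S_N) (N_gt1 : (2 <= N)%N).
Local Notation lambda := (@lebesgue_measure R).
Implicit Types (phi : R -> R) (m : R) (c : 'I_N * 'I_N).

Let N_gt0 : 0 < N%:R :> R.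
Proof. by rewrite ltr0n ltnW. Qed.

Lemma countable_Nadic : countable [set t : R | Nadic N t].
Proof.
rewrite (_ : [set t | _] = (fun p : nat * nat => p.2%:R / N%:R ^+ p.1) @` setT).
  by apply: (sub_countable (card_image_le _ _)); exact: countableP.
apply/seteqP; split => [t [n [m tE]]|_ [[n m] _ <-]] /=.
  by exists (n, m) => //=; rewrite -tE mulfK// expf_neq0// gt_eqF.
by exists n, m; rewrite divfK// expf_neq0// gt_eqF.
Qed.

Lemma measurable_Nadic : measurable ([set t | Nadic N t] : set (measurableTypeR R)).
Proof. by apply: countable_measurable; [move=> t; exact: measurable_set1|exact: countable_Nadic]. Qed.

Lemma lebesgue_measure_Nadic : lambda [set t | Nadic N t] = 0%E.
Proof. by apply: countable_lebesgue_measure0; exact: countable_Nadic. Qed.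

Definition nonneg_with_integral phi m : Prop :=
  [/\ measurable_fun setT phi, forall t, 0 <= phi t &
      (\int[lambda]_t (phi t)%:E = m%:E)%E].

(** One factor 1/N is the scaling of lengths, the other the change of variable from [t] to
    [cell_level c t]. *)
Definition length_step m : R := N%:R ^- 2 * \sum_(c : 'I_N * 'I_N)
  (if pi c.2 == c.1 then m
   else weight (Num.sqrt 2) 1 0 (slope1 pi c.1 c.2) (slope2 pi c.1 c.2)).

Lemma length_op_integral phi m : nonneg_with_integral phi m ->
  nonneg_with_integral (length_op pi phi) (length_step m).
Proof.
move=> [mphi phi0 iphi].
pose psi c : R -> R := if pi c.2 == c.1 then phi
  else linear_length (slope1 pi c.1 c.2) (slope2 pi c.1 c.2).
have mpsi c : measurable_fun setT (psi c).
  by rewrite /psi; case: ifP => // _; exact: measurable_linear_length.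
have psi0 c t : 0 <= psi c t.
  by rewrite /psi; case: ifP => // _; exact: linear_length_ge0.
have opE t : length_op pi phi t = N%:R^-1 * \sum_c psi c (N%:R * t + - (cell_base pi c.1 c.2)%:R).
  by congr (_ * _); apply: eq_bigr => c _; rewrite /psi /cell_level; case: ifP.
have mpsi' c : measurable_fun setT
    (fun t : R => psi c (N%:R * t + - (cell_base pi c.1 c.2)%:R)).
  by apply: (measurableT_comp (mpsi c)); apply: measurable_funD => //; exact: measurable_funM.
have msum : measurable_fun setT
    (fun t : R => \sum_c psi c (N%:R * t + - (cell_base pi c.1 c.2)%:R)).
  exact: measurable_sum.
split.
- by rewrite (funext opE); exact: measurable_funM.
- by move=> t; rewrite opE mulr_ge0 ?invr_ge0// sumr_ge0.
rewrite (_ : (fun t => _) = (fun t : R => (N%:R^-1)%:E *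
    \sum_c (psi c (N%:R * t + - (cell_base pi c.1 c.2)%:R))%:E)%E); last first.
  by apply/funext => t; rewrite opE EFinM sumEFin.
rewrite ge0_integralZl//; last 2 first.
- by apply: emeasurable_sum => c; apply/measurable_EFinP; exact: mpsi'.
- by move=> t _; apply: sume_ge0 => c _; rewrite lee_fin.
rewrite ge0_integral_sum//; last 2 first.
- by move=> c; apply/measurable_EFinP; exact: mpsi'.
- by move=> c t _; rewrite lee_fin.
rewrite /length_step -exprVn [in RHS]expr2 -mulrA EFinM; congr (_ * _)%E.
rewrite mulr_sumr -sumEFin; apply: eq_bigr => c _.
rewrite (@ge0_integral_affine _ _ _ (EFin \o psi c))//; last 2 first.
- exact/measurable_EFinP.
- by move=> t; rewrite lee_fin.
rewrite EFinM; congr (_ * _)%E; rewrite /psi; case: ifP => // _.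
exact: integral_linear_length.
Qed.

Definition length_const : R :=
  (N%:R * (N%:R - 1) + (Num.sqrt 2 - 2) * #|dominated_pairs pi|%:R) / N%:R ^+ 2.

Lemma length_stepE m : length_step m = length_const + N%:R^-1 * m.
Proof.
rewrite /length_step sum_weight/= /length_const; field; rewrite gt_eqF//.
Qed.

Lemma length_constE : length_const * (N%:R / (N%:R - 1)) =
  1 - (2 - Num.sqrt 2) * (1 / (N%:R * (N%:R - 1))) * #|dominated_pairs pi|%:R.
Proof.
have N2 : 2 <= N%:R :> R by rewrite ler_nat.
rewrite /length_const; field; apply/andP; split; apply: lt0r_neq0; lra.
Qed.

Lemma iter_length_op_integral n phi m : nonneg_with_integral phi m ->
  nonneg_with_integral (iter n (length_op pi) phi) (iter n length_step m).
Proof. by move=> pm; elim: n => //= n ih; exact: length_op_integral. Qed.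

Lemma cvg_iter_length_step m :
  (iter n length_step m)%:E @[n --> \oo] --> (length_const * (N%:R / (N%:R - 1)))%:E.
Proof.
apply: cvg_EFin; first exact: nearW.
apply: (@cvg_affine_recurrence _ N length_const (fun n => iter n length_step m)) => // n.
by rewrite /= length_stepE.
Qed.

Variable A : copula R.
Hypothesis hA : eq_on_square (joint_cdf (Vop pi (copula_measure A))) A.

Lemma hausdorff1_ge0 (S : set (R * R)) : (0 <= hausdorff1 S)%E.
Proof.
apply: le_trans (hausdorff1_pre_ge0 1 S) _.
by apply: ereal_sup_ubound; exists 1 => //=; exact: ltr01.
Qed.

Lemma hausdorff1_set0 (S : set (R * R)) : (forall p, ~ S p) -> hausdorff1 S = 0%E.
Proof.
move=> S0; apply/eqP; rewrite eq_le hausdorff1_ge0 andbT.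
by apply: ge_ereal_sup => _ [d /= d0 <-]; rewrite hausdorff1_pre_set0// ltW.
Qed.

(** The value [sqrt 2] bounds the diameter of a level curve, not its length; outside (0, 1) the
    curve is empty. *)
Let top_fun (s : R) : R := Num.sqrt 2 * \1_(`]0, 1[%classic) s.

(** At a fixed scale [d] all late iterates are upper bounds, hence so is their lower limit, which
    does not depend on [d]. *)
Lemma hausdorff1_level_le t : ~ Nadic N t ->
  (hausdorff1 (level_boundary A t) <=
   limn_einf (fun n => (iter n (length_op pi) top_fun t)%:E))%E.
Proof.
move=> tN; apply: ge_ereal_sup => _ [d /= d0 <-]; rewrite limn_einf_lim.
pose n0 := Num.bound (Num.sqrt 2 / d).
apply: lime_ge; first exact: is_cvg_einfs.
exists n0 => // n /= n0n; apply: le_ereal_inf_tmp => _ [k /= nk <-].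
apply: hausdorff1_pre_level_le => //; rewrite -ler_pdivrMr//.
apply: le_trans (ltW (archi_boundP _)) _; first by rewrite divr_ge0 ?sqrtr_ge0// ltW.
rewrite -/n0 -natrX ler_nat; apply: leq_trans (leq_trans n0n nk) _.
by rewrite ltnW// ltn_expl.
Qed.

Lemma length_measure_fixpoint : length_measure A =
  (1 - (2 - Num.sqrt 2) * (1 / (N%:R * (N%:R - 1))) * #|dominated_pairs pi|%:R)%:E.
Proof.
rewrite -length_constE; set l := (_ * _).
pose L t := hausdorff1 (level_boundary A t).
have L0 t : (0 <= L t)%E by exact: hausdorff1_ge0.
have -> : length_measure A = (\int[lambda]_t L t)%E.
  rewrite /length_measure integral_mkcond; apply: eq_integral => t _.
  rewrite patchE; case: ifPn => // t01; rewrite /L hausdorff1_set0//.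
  by move=> p /level_boundary_out tI; move: t01; rewrite notin_setE /= in_itv/= tI.
apply/eqP; rewrite eq_le; apply/andP; split.
  have top_int : nonneg_with_integral top_fun (Num.sqrt 2).
    split.
    - by apply: measurable_funM => //; apply: measurable_indic; exact: measurable_itv.
    - by move=> t; rewrite mulr_ge0 ?sqrtr_ge0// indicE.
    rewrite (_ : (fun t => _) = (fun t : R => (Num.sqrt 2)%:E * (\1_(`]0%R, 1%R[%classic) t)%:E)%E).
      rewrite ge0_integralZl//; last first.
        by apply/measurable_EFinP; apply: measurable_indic; exact: measurable_itv.
      rewrite integral_indic// setIT -[RHS]mule1; congr (_ * _)%E.
      exact: lebesgue_measure_unit_itv.
    by apply/funext => t; rewrite -EFinM.
  have iter_int n := iter_length_op_integral n top_int.
  have mit n : measurable_fun setT (EFin \o iter n (length_op pi) top_fun).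
    by have [? _ _] := iter_int n; exact/measurable_EFinP.
  have it0 n t : (0 <= (iter n (length_op pi) top_fun t)%:E)%E.
    by have [_ ? _] := iter_int n; rewrite lee_fin.
  apply: (@le_trans _ _ (\int[lambda]_t
      limn_einf (fun n => (iter n (length_op pi) top_fun t)%:E))%E).
    apply: (ge0_le_integral_negl measurable_Nadic lebesgue_measure_Nadic) => //.
      move=> t _; rewrite limn_einf_lim; apply: lime_ge; first exact: is_cvg_einfs.
      by apply: nearW => n; apply: le_ereal_inf_tmp => _ [k _ <-].
    by move=> t _; exact: hausdorff1_level_le.
  (* Fatou's lemma moves the lower limit outside the integral, where it becomes the limit of the
     affine recurrence. *)
  apply: le_trans (fatou lambda measurableT mit (fun n t _ => it0 n t)) _.
  rewrite (_ : (fun n => _) = (fun n => (iter n length_step (Num.sqrt 2))%:E)); last first.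
    by apply/funext => n; have [_ _] := iter_int n.
  rewrite is_cvg_limn_einfE; last by apply: cvgP; exact: cvg_iter_length_step.
  by rewrite (cvg_lim _ (cvg_iter_length_step _)).
have zero_int : nonneg_with_integral (fun=> 0) 0.
  by split => //; rewrite integral0.
rewrite -(cvg_lim _ (cvg_iter_length_step 0))//; apply: lime_le.
  by apply: cvgP; exact: cvg_iter_length_step.
apply: nearW => n; have [mit it0 <-] := iter_length_op_integral n zero_int.
apply: (@ge0_le_integral_negl _ _ _ _ _ set0) => //.
  by move=> t _; rewrite lee_fin.
by move=> t _ _; apply: hausdorff1_ge; exact: level_boundary_length_ge.
Qed.

End length_measure.

(** * The surface area *)

Section derive1_tools.
Context {R : realType}.
Implicit Types (g : R -> R) (x a b c r : R).

(** All difference quotients lie in [0, 1]; where they do not converge, [lim] returns [point], which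
    the bound allows for. *)
Lemma derive1_bounded g x : {homo g : y z / y <= z} ->
  (forall y z, y <= z -> g z <= g y + (z - y)) ->
  `|derive1 g x| <= 1 + `|point : R|.
Proof.
move=> gmono glip; rewrite /derive1.
set F := (X in lim X).
have [cF|dF] := pselect (cvg F); last first.
  by rewrite (dvgP dF) ler_wpDl.
have quot h : h != 0 -> 0 <= h^-1 *: (g (h + x) - g x) <= 1.
  move=> h0; rewrite /GRing.scale /=; have [hp|hn] := ltP 0 h.
    rewrite mulr_ge0 ?invr_ge0 ?(ltW hp) ?subr_ge0 ?gmono ?lerDr ?(ltW hp)//=.
    rewrite ler_pdivrMl// mulr1 lerBlDl.
    by have := glip x (h + x); rewrite lerDr addrK ltW// => /(_ isT).
  have {h0}hn : h < 0 by rewrite lt_neqAle h0.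
  rewrite mulr_le0 ?invr_le0 ?(ltW hn) ?subr_le0 ?gmono ?gerDr ?(ltW hn)//=.
  rewrite -[h^-1]opprK mulNr -mulrN opprB -invrN ler_pdivrMl ?oppr_gt0// mulr1 lerBlDl.
  have -> : - h = x - (h + x) by ring.
  by apply: glip; rewrite gerDr ltW.
rewrite ler_wpDr// ger0_norm.
  apply: limr_le => //; near=> h.
  by have /andP[] : 0 <= h^-1 *: (g (h + x) - g x) <= 1 by apply: quot; near: h; exact: nbhs_dnbhs_neq.
apply: limr_ge => //; near=> h.
by have /andP[] : 0 <= h^-1 *: (g (h + x) - g x) <= 1 by apply: quot; near: h; exact: nbhs_dnbhs_neq.
Unshelve. all: by end_near. Qed.

Lemma derive1_linear a b x : derive1 (fun s => a * s + b) x = a.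
Proof.
rewrite /derive1; apply: cvg_lim => //.
apply: (@cvg_trans _ ((fun=> a) @ (0 : R)^')); last exact: cvg_cst.
apply: near_eq_cvg; near=> h.
have h0 : h != 0 by near: h; exact: nbhs_dnbhs_neq.
by rewrite /GRing.scale /=; field.
Unshelve. all: by end_near. Qed.

(* Stated with equality of the limits even when [g] is not derivable. *)
Lemma derive1_rescale g c r b x : 0 < r ->
  derive1 (fun s => c + r^-1 * g (r * s - b)) x = derive1 g (r * x - b).
Proof.
move=> r0; rewrite /derive1; congr (lim _).
have E h : h^-1 *: (c + r^-1 * g (r * (h + x) - b) - (c + r^-1 * g (r * x - b))) =
    (r * h)^-1 *: (g (r * h + (r * x - b)) - g (r * x - b)).
  have -> : r * (h + x) - b = r * h + (r * x - b) by ring.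
  by rewrite /GRing.scale /= invfM; ring.
rewrite (_ : (fun h => _) = (fun h => (r * h)^-1 *: (g (r * h + (r * x - b)) - g (r * x - b)))); last first.
  by apply/funext => h; rewrite E.
pose q h := h^-1 *: (g (h + (r * x - b)) - g (r * x - b)).
apply/seteqP; split => P; rewrite /fmap /= /nbhs /=.
  move=> [e /= e0 eP]; exists (r * e) => /=; first by rewrite mulr_gt0.
  move=> h /=; rewrite sub0r normrN => he h0.
  rewrite -[h](@mulVKf _ r) ?gt_eqF//; apply: (eP (r^-1 * h)) => /=.
    by rewrite sub0r normrN normrM gtr0_norm ?invr_gt0// mulrC ltr_pdivrMr// mulrC.
  by rewrite mulf_neq0// invr_eq0 gt_eqF.
move=> [e /= e0 eP]; exists (r^-1 * e) => /=; first by rewrite mulr_gt0// invr_gt0.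
move=> h /=; rewrite sub0r normrN => he h0.
apply: (eP (r * h)) => /=; last by rewrite mulf_neq0// gt_eqF.
by rewrite sub0r normrN normrM (gtr0_norm r0) -ltr_pdivlMl.
Qed.

Lemma near_eq_derive1 (f g : R -> R) x : (\forall y \near x, f y = g y) ->
  derive1 f x = derive1 g x.
Proof. by move=> fg; rewrite !derive1E; exact: near_eq_derive. Qed.

End derive1_tools.

(** * The surface density on the cells *)

Section surface_density.
Context {R : realType} (N : nat) (pi : 'S_N) (N_gt1 : (2 <= N)%N) (A : copula R).
Hypothesis hA : eq_on_square (joint_cdf (Vop pi (copula_measure A))) A.
Implicit Types (u v x y : R) (p q : R * R) (j k : 'I_N) (c : 'I_N * 'I_N).

Let N_gt0 : 0 < N%:R :> R.
Proof. by rewrite ltr0n ltnW. Qed.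

Definition surf_density p : R :=
  Num.sqrt (derive1 (fun s => A s p.2) p.1 ^+ 2
          + derive1 (fun s => A p.1 s) p.2 ^+ 2 + 1).

Lemma surf_density_ge0 p : 0 <= surf_density p.
Proof. exact: sqrtr_ge0. Qed.

(* [derive1] is [point] where the derivative does not exist. *)
Definition surf_density_bound : R :=
  Num.sqrt ((1 + `|point : R|) ^+ 2 + (1 + `|point : R|) ^+ 2 + 1).

Lemma surf_density_le p : surf_density p <= surf_density_bound.
Proof.
rewrite ler_wsqrtr// lerD2r lerD// -[leLHS]real_normK ?num_real//
  lerXn2r ?nnegrE ?addr_ge0// derive1_bounded//.
- by move=> y z yz; exact: copula_mono.
- by move=> y z; exact: copula_lip1.
- by move=> y z yz; exact: copula_mono.
- by move=> y z; exact: copula_lip2.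
Qed.

Lemma near_cell j u : 0 < u < 1 ->
  \forall s \near (j%:R + u) / N%:R, 0 < N%:R * s - j%:R < 1.
Proof.
move=> /andP[u0 u1]; pose e := Num.min u (1 - u) / N%:R.
have m0 : 0 < Num.min u (1 - u) by rewrite lt_min u0; lra.
have [m1 m2] : Num.min u (1 - u) <= u /\ Num.min u (1 - u) <= 1 - u.
  by rewrite !ge_min !lexx ?orbT.
have e0 : 0 < e by rewrite divr_gt0.
exists e => //= s /=; rewrite ltr_norml => /andP[].
rewrite /e -mulNr ltr_pdivrMr// ltr_pdivlMr// mulrBl divfK ?gt_eqF// [s * _]mulrC.
by move=> ? ?; apply/andP; split; lra.
Qed.

(** Over the graph of [pi] the scalings of argument and value cancel, so the derivative reappears
    unchanged; elsewhere [A] is affine in the cell. *)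
Lemma derive1_cell1 j k u v : 0 < u < 1 -> 0 < v < 1 ->
  derive1 (fun s => A s ((k%:R + v) / N%:R)) ((j%:R + u) / N%:R) =
  if pi k == j then derive1 (fun s => A s v) u else (slope1 pi j k)%:R.
Proof.
move=> uI /andP[/ltW v0 /ltW v1].
have E s : 0 < N%:R * s - j%:R < 1 -> A s ((k%:R + v) / N%:R) =
   N%:R^-1 * ((cell_base pi j k)%:R + (slope1 pi j k)%:R * (N%:R * s - j%:R)
    + (slope2 pi j k)%:R * v + (pi k == j)%:R * A (N%:R * s - j%:R) v).
  move=> /andP[/ltW ? /ltW ?]; rewrite -(copula_cell N_gt1 hA) ?v0 ?v1//.
    by congr (A _ _); rewrite subrKC mulrC mulKf// gt_eqF.
  by apply/andP.
case: ifPn => [/eqP kj|kj].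
  rewrite (@near_eq_derive1 _ _ (fun s => N%:R^-1 * (cell_base pi j k)%:R +
     N%:R^-1 * A (N%:R * s - j%:R) v)).
    rewrite (@derive1_rescale _ (fun s => A s v))//; congr derive1.
    by rewrite mulrC divfK ?gt_eqF// addrAC subrr add0r.
  near=> s; rewrite E; last by near: s; exact: near_cell.
  by rewrite !(slope_diag kj) kj eqxx /=; ring.
rewrite (@near_eq_derive1 _ _ (fun s => (slope1 pi j k)%:R * s +
   N%:R^-1 * ((cell_base pi j k)%:R - (slope1 pi j k)%:R * j%:R + (slope2 pi j k)%:R * v))).
  exact: derive1_linear.
near=> s; rewrite E; last by near: s; exact: near_cell.
by rewrite (negbTE kj) /=; field; rewrite gt_eqF.
Unshelve. all: by end_near. Qed.

Lemma derive1_cell2 j k u v : 0 < u < 1 -> 0 < v < 1 ->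
  derive1 (fun s => A ((j%:R + u) / N%:R) s) ((k%:R + v) / N%:R) =
  if pi k == j then derive1 (fun s => A u s) v else (slope2 pi j k)%:R.
Proof.
move=> /andP[/ltW u0 /ltW u1] vI.
have E s : 0 < N%:R * s - k%:R < 1 -> A ((j%:R + u) / N%:R) s =
   N%:R^-1 * ((cell_base pi j k)%:R + (slope1 pi j k)%:R * u
    + (slope2 pi j k)%:R * (N%:R * s - k%:R) + (pi k == j)%:R * A u (N%:R * s - k%:R)).
  move=> /andP[/ltW ? /ltW ?]; rewrite -(copula_cell N_gt1 hA) ?u0 ?u1//.
    by congr (A _ _); rewrite subrKC mulrC mulKf// gt_eqF.
  by apply/andP.
case: ifPn => [/eqP kj|kj].
  rewrite (@near_eq_derive1 _ _ (fun s => N%:R^-1 * (cell_base pi j k)%:R +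
     N%:R^-1 * A u (N%:R * s - k%:R))).
    rewrite (@derive1_rescale _ (fun s => A u s))//; congr derive1.
    by rewrite mulrC divfK ?gt_eqF// addrAC subrr add0r.
  near=> s; rewrite E; last by near: s; exact: near_cell.
  by rewrite !(slope_diag kj) kj eqxx /=; ring.
rewrite (@near_eq_derive1 _ _ (fun s => (slope2 pi j k)%:R * s +
   N%:R^-1 * ((cell_base pi j k)%:R - (slope2 pi j k)%:R * k%:R + (slope1 pi j k)%:R * u))).
  exact: derive1_linear.
near=> s; rewrite E; last by near: s; exact: near_cell.
by rewrite (negbTE kj) /=; field; rewrite gt_eqF.
Unshelve. all: by end_near. Qed.

Lemma surf_density_cell c q : open_square q ->
  surf_density (cell_map c.1 c.2 q) = if pi c.2 == c.1 then surf_density q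
    else weight (Num.sqrt 3) (Num.sqrt 2) 1 (slope1 pi c.1 c.2) (slope2 pi c.1 c.2).
Proof.
case: c q => j k [u v] /open_squareE[/= uI vI].
rewrite /surf_density /= derive1_cell1// derive1_cell2//; case: ifP => // _.
rewrite /weight; case: slope1; case: slope2; rewrite /= ?expr1n ?expr0n/= ?addr0 ?add0r ?sqrtr1//.
by congr Num.sqrt; ring.
Qed.

End surface_density.

(** * Integration of the surface density *)

Section surface_integral.
Context {R : realType} (N : nat) (pi : 'S_N) (N_gt1 : (2 <= N)%N).
Local Notation R2 := (measurableTypeR R * measurableTypeR R)%type.
Implicit Types (phi : R * R -> R) (m : R) (p q : R * R) (c : 'I_N * 'I_N).

Let N_gt0 : 0 < N%:R :> R.
Proof. by rewrite ltr0n ltnW. Qed.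

Let surf_weight c : R :=
  weight (Num.sqrt 3) (Num.sqrt 2) 1 (slope1 pi c.1 c.2) (slope2 pi c.1 c.2).

Let surf_weight_ge0 c : 0 <= surf_weight c.
Proof. by rewrite /surf_weight /weight; do 2 case: ifP => //; rewrite sqrtr_ge0. Qed.

Definition cell_inv c : R * R -> R * R := affine2 N%:R (- c.1%:R) (- c.2%:R).

Lemma cell_mapK c : cancel (cell_map c.1 c.2) (cell_inv c).
Proof.
by case=> u v; rewrite /cell_inv /cell_map /affine2 /=; congr pair; field; rewrite gt_eqF.
Qed.

Lemma cell_invK c : cancel (cell_inv c) (cell_map c.1 c.2).
Proof.
by case=> u v; rewrite /cell_inv /cell_map /affine2 /=; congr pair; field; rewrite gt_eqF.
Qed.

Lemma cell_inv_uniq c c' p : open_square (cell_inv c p) ->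
  open_square (cell_inv c' p) -> c = c'.
Proof.
have uniq (a b : 'I_N) (x : R) : 0 < N%:R * x - a%:R < 1 ->
    0 < N%:R * x - b%:R < 1 -> a = b.
  move=> /andP[? ?] /andP[? ?]; apply/val_inj => /=.
  case: (ltngtP a b) => // ab; exfalso.
    have {ab} : a.+1%:R <= b%:R :> R by rewrite ler_nat.
    by rewrite -natr1; lra.
  have {ab} : b.+1%:R <= a%:R :> R by rewrite ler_nat.
  by rewrite -natr1; lra.
case: c c' => [j k] [j' k'] /open_squareE[/= ? ?] /open_squareE[/= ? ?].
by congr pair; [apply: (uniq _ _ p.1)|apply: (uniq _ _ p.2)].
Qed.

(** If [phi] vanishes off the open square, at most one summand is nonzero, that of the open cell
    containing [p]; on the grid lines the sum is 0. *)
Definition surf_op phi p : R := \sum_c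
  (if pi c.2 == c.1 then phi (cell_inv c p)
   else surf_weight c * \1_open_square (cell_inv c p)).

Definition supported_in_square phi := forall p, ~ open_square p -> phi p = 0.

Lemma surf_op_cell phi c q : supported_in_square phi -> open_square q ->
  surf_op phi (cell_map c.1 c.2 q) =
  if pi c.2 == c.1 then phi q else surf_weight c.
Proof.
move=> phi0 oq; rewrite /surf_op (bigD1 c)//= cell_mapK indicE (mem_set oq) mulr1.
rewrite big1 ?addr0// => c' cc'.
have noq : ~ open_square (cell_inv c' (cell_map c.1 c.2 q)).
  move=> oq'; move: cc'; rewrite (@cell_inv_uniq c' c (cell_map c.1 c.2 q)) ?eqxx//.
  by rewrite cell_mapK.
by rewrite (phi0 _ noq) indicE memNset// mulr0; case: ifP.
Qed.

Lemma surf_op_notin phi p : supported_in_square phi ->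
  (forall c, ~ open_square (cell_inv c p)) -> surf_op phi p = 0.
Proof.
move=> phi0 pc; rewrite /surf_op big1// => c _.
by rewrite (phi0 _ (pc c)) indicE memNset// mulr0; case: ifP.
Qed.

Lemma open_square_cell c q : open_square q -> open_square (cell_map c.1 c.2 q).
Proof.
case: c q => j k [u v] /open_squareE[/= /andP[u0 u1] /andP[v0 v1]].
have jN : j%:R + 1 <= N%:R :> R by rewrite natr1 ler_nat.
have kN : k%:R + 1 <= N%:R :> R by rewrite natr1 ler_nat.
by split; rewrite /= in_itv/= divr_gt0 ?ltr_wpDl//= ltr_pdivrMr// mul1r; lra.
Qed.

Lemma surf_op_supported phi : supported_in_square phi ->
  supported_in_square (surf_op phi).
Proof.
move=> phi0 p np; apply: surf_op_notin => // c oc; apply: np.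
by rewrite -(cell_invK c p); exact: open_square_cell.
Qed.

Definition nonneg_with_integral2 phi m : Prop :=
  [/\ measurable_fun setT (phi : R2 -> R), forall t, 0 <= phi t,
      supported_in_square phi & (\int[leb2]_p (phi p)%:E = m%:E)%E].

Definition surf_step m : R := N%:R ^- 2 * \sum_(c : 'I_N * 'I_N)
  (if pi c.2 == c.1 then m else surf_weight c).

Lemma measurable_open_square : measurable (open_square : set R2).
Proof. by apply: measurableX; exact: measurable_itv. Qed.

Lemma leb2_open_square : leb2 (open_square : set R2) = 1%E.
Proof.
rewrite leb2X; [|exact: measurable_itv|exact: measurable_itv].
by rewrite !lebesgue_measure_unit_itv mule1.
Qed.

Lemma scaled_square_integral m : 0 <= m ->
  nonneg_with_integral2 (fun p => m * \1_open_square p) m.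
Proof.
move=> m0; have mo := measurable_open_square.
split.
- by apply: measurable_funM => //; exact: measurable_indic.
- by move=> p; rewrite mulr_ge0// indicE.
- by move=> p np; rewrite indicE memNset ?mulr0.
rewrite (_ : (fun p : R * R => _) = (fun p : R2 => m%:E * (\1_open_square p)%:E)%E); last first.
  by apply/funext => p; rewrite -EFinM.
rewrite ge0_integralZl//; last first.
  by apply/measurable_EFinP; exact: measurable_indic.
by rewrite integral_indic// setIT -[RHS]mule1; congr (_ * _)%E; exact: leb2_open_square.
Qed.

Lemma surf_op_integral phi m : nonneg_with_integral2 phi m ->
  nonneg_with_integral2 (surf_op phi) (surf_step m).
Proof.
move=> [mphi phi0 phis iphi].
pose psi c : R * R -> R := if pi c.2 == c.1 then phi
  else fun q => surf_weight c * \1_open_square q.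
have psiP c : nonneg_with_integral2 (psi c) (if pi c.2 == c.1 then m else surf_weight c).
  by rewrite /psi; case: ifP => // _; exact: scaled_square_integral.
have opE p : surf_op phi p = \sum_c psi c (cell_inv c p).
  by apply: eq_bigr => c _; rewrite /psi; case: ifP.
have mpsi c : measurable_fun setT (fun p : R2 => psi c (cell_inv c p)).
  have [mc _ _ _] := psiP c.
  by apply: (measurableT_comp mc); exact: measurable_affine2.
split.
- by rewrite (funext opE); exact: measurable_sum.
- by move=> p; rewrite opE sumr_ge0// => c _; have [_ + _ _] := psiP c.
- exact: surf_op_supported.
rewrite (_ : (fun p => _) = (fun p : R2 => \sum_c (psi c (cell_inv c p))%:E)%E); last first.
  by apply/funext => p; rewrite opE sumEFin.
rewrite ge0_integral_sum//; last 2 first.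
- by move=> c; apply/measurable_EFinP; exact: mpsi.
- by move=> c p _; rewrite lee_fin; have [_ + _ _] := psiP c.
rewrite /surf_step mulr_sumr -sumEFin; apply: eq_bigr => c _.
have [mc c0 _ ic] := psiP c; rewrite EFinM -ic.
rewrite -(@ge0_integral_affine2 _ N%:R (- c.1%:R) (- c.2%:R) (EFin \o psi c))//.
exact/measurable_EFinP.
Qed.

Definition surf_const : R :=
  (Num.sqrt 2 * (N%:R * (N%:R - 1))
   - (2 * Num.sqrt 2 - 1 - Num.sqrt 3) * #|dominated_pairs pi|%:R) / N%:R ^+ 2.

Lemma surf_stepE m : surf_step m = surf_const + N%:R^-1 * m.
Proof. by rewrite /surf_step sum_weight/= /surf_const; field; rewrite gt_eqF. Qed.

Lemma surf_constE : surf_const * (N%:R / (N%:R - 1)) = Num.sqrt 2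
  - (2 * Num.sqrt 2 - 1 - Num.sqrt 3) * (1 / (N%:R * (N%:R - 1))) * #|dominated_pairs pi|%:R.
Proof.
have N2 : 2 <= N%:R :> R by rewrite ler_nat.
rewrite /surf_const; field; apply/andP; split; apply: lt0r_neq0; lra.
Qed.

Lemma iter_surf_op_integral n phi m : nonneg_with_integral2 phi m ->
  nonneg_with_integral2 (iter n surf_op phi) (iter n surf_step m).
Proof. by move=> pm; elim: n => //= n ih; exact: surf_op_integral. Qed.

Lemma cvg_iter_surf_step m :
  (iter n surf_step m)%:E @[n --> \oo] --> (surf_const * (N%:R / (N%:R - 1)))%:E.
Proof.
apply: cvg_EFin; first exact: nearW.
apply: (@cvg_affine_recurrence _ N surf_const (fun n => iter n surf_step m)) => // n.
by rewrite /= surf_stepE.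
Qed.

Definition Nadic_lines : set (R * R) := [set p | Nadic N p.1 \/ Nadic N p.2].

Lemma Nadic_linesE : Nadic_lines =
  ([set t | Nadic N t] `*` setT) `|` (setT `*` [set t | Nadic N t]).
Proof.
apply/seteqP; split => -[x y] /=; first by case=> ?; [left|right].
by case=> -[? ?]; [left|right].
Qed.

Lemma measurable_Nadic_lines : measurable (Nadic_lines : set R2).
Proof.
by rewrite Nadic_linesE; apply: measurableU; apply: measurableX => //; exact: measurable_Nadic.
Qed.

Lemma leb2_Nadic_lines : leb2 (Nadic_lines : set R2) = 0%E.
Proof.
have mN := measurable_Nadic N_gt1.
have E1 : leb2 ([set t | Nadic N t] `*` setT : set R2) = 0%E.
  by rewrite leb2X// lebesgue_measure_Nadic// mul0e.
have E2 : leb2 (setT `*` [set t | Nadic N t] : set R2) = 0%E.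
  by rewrite leb2X// lebesgue_measure_Nadic// mule0.
rewrite Nadic_linesE; apply/eqP; rewrite eq_le measure_ge0 andbT.
apply: le_trans (measureU2 _ _ _) _; [exact: measurableX|exact: measurableX|].
by rewrite [X in (X + _)%E]E1 [X in (_ + X)%E]E2 adde0.
Qed.

Lemma Nadic_cell_coord (j : nat) (u x : R) : x = (j%:R + u) / N%:R -> Nadic N u -> Nadic N x.
Proof.
move=> -> [n [m nm]]; exists n.+1, (m + j * N ^ n)%N.
by rewrite natrD natrM natrX -nm exprS; field; rewrite gt_eqF.
Qed.

Lemma exists_open_cell_coord (x : R) : 0 < x -> x < 1 -> ~ Nadic N x ->
  exists (j : 'I_N) (u : R), [/\ 0 < u < 1, x = (j%:R + u) / N%:R & ~ Nadic N u].
Proof.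
move=> xgt0 xlt1 nx.
have [|j [u [/andP[u0 u1] xE]]] := exists_cell_coord N_gt1 (_ : 0 <= x < 1).
  by rewrite ltW.
exists j, u; have nu : ~ Nadic N u by move=> /(Nadic_cell_coord xE).
split => //; rewrite u1 andbT lt_neqAle u0 andbT eq_sym; apply/eqP => u00.
by apply: nu; exists 0%N, 0%N; rewrite u00 mul0r.
Qed.

Variable A : copula R.
Hypothesis hA : eq_on_square (joint_cdf (Vop pi (copula_measure A))) A.

(** No exceptional set is needed: on the grid lines the iterates vanish and the density is
    nonnegative. *)
Lemma iter_surf_op_le n p : iter n surf_op (fun=> 0) p <= surf_density A p.
Proof.
have [_ _ + _] : nonneg_with_integral2 (fun=> 0) 0.
  have := scaled_square_integral (lexx 0); rewrite (_ : (fun p : R * R => _) = fun=> 0)//.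
  by apply/funext => q; rewrite mul0r.
move=> s0; have sn k : supported_in_square (iter k surf_op (fun=> 0)).
  by elim: k => //= k ih; exact: surf_op_supported.
elim: n p => [|n ih] p /=; first exact: surf_density_ge0.
have [[c oc]|nc] := pselect (exists c, open_square (cell_inv c p)); last first.
  rewrite surf_op_notin ?surf_density_ge0// => c oc; apply: nc; by exists c.
rewrite -(cell_invK c p) surf_op_cell// (surf_density_cell N_gt1 hA)//.
by case: ifP.
Qed.

(** Off the N-adic lines a point of the open square lies in an open cell, and its cell coordinates
    are again off these lines, so the recursion never meets the grid. *)
Lemma surf_density_le_iter n p : open_square p -> ~ Nadic_lines p ->
  surf_density A p <= iter n surf_op (fun q => @surf_density_bound R * \1_open_square q) p.
Proof.
have [_ _ s0 _] := scaled_square_integral (sqrtr_ge0 _ : 0 <= @surf_density_bound R).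
set f0 := (fun q => _) in s0 *.
have sn k : supported_in_square (iter k surf_op f0).
  by elim: k => //= k ih; exact: surf_op_supported.
elim: n p => [|n ih] p op np /=.
  by rewrite /f0 indicE (mem_set op) mulr1 surf_density_le.
have [/andP[x0 x1] /andP[y0 y1]] := open_squareE op.
have [j [u [uI pu nu]]] := exists_open_cell_coord x0 x1 (fun h => np (or_introl h)).
have [k [v [vI pv nv]]] := exists_open_cell_coord y0 y1 (fun h => np (or_intror h)).
have pE : p = cell_map (j, k).1 (j, k).2 (u, v).
  by case: p pu pv {op np x0 x1 y0 y1} => x y /= -> ->.
have ouv : open_square (u, v) by split.
rewrite pE (surf_density_cell N_gt1 hA (j, k))// surf_op_cell//; case: ifP => // _.
by apply: ih => // -[].
Qed.

Lemma surf_fixpoint : surf A = (Num.sqrt 2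
  - (2 * Num.sqrt 2 - 1 - Num.sqrt 3) * (1 / (N%:R * (N%:R - 1))) * #|dominated_pairs pi|%:R)%:E.
Proof.
have -> : surf A = (\int[leb2]_(p in square) (surf_density A p)%:E)%E by [].
rewrite -surf_constE; set l := (_ * _).
have b0 : 0 <= @surf_density_bound R by exact: sqrtr_ge0.
apply/eqP; rewrite eq_le; apply/andP; split.
  rewrite -(cvg_lim _ (cvg_iter_surf_step (@surf_density_bound R)))//; apply: lime_ge.
    by apply: cvgP; exact: cvg_iter_surf_step.
  apply: nearW => n.
  have [mit it0 its <-] := iter_surf_op_integral n (scaled_square_integral b0).
  rewrite integral_mkcond.
  apply: (ge0_le_integral_negl measurable_Nadic_lines leb2_Nadic_lines).
  - by move=> p _; rewrite erestrict_ge0// => q _; rewrite lee_fin surf_density_ge0.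
  - by move=> p _; rewrite lee_fin.
  move=> p _ np; rewrite patchE; case: ifPn => [|_]; last by rewrite lee_fin.
  rewrite inE => sp; rewrite lee_fin; apply: surf_density_le_iter => //.
  case: sp; rewrite /I01 /= !in_itv/= => /andP[x0 x1] /andP[y0 y1].
  have N0 (x : R) : ~ Nadic N x -> x != 0.
    by move=> nx; apply/eqP => x00; apply: nx; exists 0%N, 0%N; rewrite x00 mul0r.
  have N1 (x : R) : ~ Nadic N x -> x != 1.
    by move=> nx; apply/eqP => x00; apply: nx; exists 0%N, 1%N; rewrite x00 mul1r.
  have npx : ~ Nadic N p.1 by move=> h; apply: np; left.
  have npy : ~ Nadic N p.2 by move=> h; apply: np; right.
  by split; rewrite /= in_itv/= !lt_neqAle eq_sym ?N0 ?N1 ?x0 ?x1 ?y0 ?y1.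
rewrite -(cvg_lim _ (cvg_iter_surf_step 0))//; apply: lime_le.
  by apply: cvgP; exact: cvg_iter_surf_step.
apply: nearW => n.
have zero_int : nonneg_with_integral2 (fun=> 0) 0.
  have := scaled_square_integral (lexx 0); rewrite (_ : (fun p : R * R => _) = fun=> 0)//.
  by apply/funext => q; rewrite mul0r.
have [mit it0 its <-] := iter_surf_op_integral n zero_int.
rewrite [leRHS]integral_mkcond.
apply: (@ge0_le_integral_negl _ _ _ _ _ set0) => //.
- by move=> p _; rewrite lee_fin.
- by move=> p _; rewrite erestrict_ge0// => q _; rewrite lee_fin surf_density_ge0.
move=> p _ _; rewrite patchE; case: ifPn => [_|sp].
  by rewrite lee_fin iter_surf_op_le.
rewrite its// => /open_squareE[/andP[? ?] /andP[? ?]].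
move: sp; rewrite notin_setE; apply.
by split; rewrite /I01 /= in_itv/=; apply/andP; split; exact: ltW.
Qed.

End surface_integral.

(** * Kendall's tau *)

Section quadrant_uniqueness.
Context {R : realType}.
Local Notation R2 := (measurableTypeR R * measurableTypeR R)%type.

Definition quadrants : set (set R2) := [set Q | exists x y : R, Q = quadrant x y].

Let ray_bigcup1 (x : R) :
  [set p : R2 | p.1 <= x] = \bigcup_n quadrant x n%:R.
Proof.
apply/seteqP; split => [[u v] /= ux|[u v] [n _ []]]; last first.
  by rewrite /= !in_itv.
exists (Num.bound `|v|) => //; split; rewrite /= in_itv/= ?ux//.
by rewrite (le_trans (ler_norm _))// ltW// archi_boundP.
Qed.

Let ray_bigcup2 (y : R) :
  [set p : R2 | p.2 <= y] = \bigcup_n quadrant n%:R y.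
Proof.
apply/seteqP; split => [[u v] /= ux|[u v] [n _ []]]; last first.
  by rewrite /= !in_itv.
exists (Num.bound `|u|) => //; split; rewrite /= in_itv/= ?ux//.
by rewrite (le_trans (ler_norm _))// ltW// archi_boundP.
Qed.

(** Half-planes are countable unions of quadrants, so both coordinate projections are measurable for
    the sigma-algebra that the quadrants generate. *)
Lemma measurable_quadrantsE : measurable = <<s quadrants >>.
Proof.
rewrite eqEsubset; split; last first.
  apply: smallest_sub; first exact: sigma_algebra_measurable.
  by move=> _ [x [y ->]]; exact: measurable_quadrant.
have m1 : measurable_fun setT (fst : g_sigma_algebraType quadrants -> measurableTypeR R).
  apply: (measurability (@RGenOInfty.G R)); first exact: RGenOInfty.measurableE.
  move=> _ [_ [x ->] <-]; rewrite setTI.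
  rewrite (_ : fst @^-1` _ = ~` [set p : R2 | p.1 <= x]); last first.
    apply/seteqP; split => p /=; rewrite in_itv/= andbT; first by rewrite ltNge => /negP.
    by move=> /negP; rewrite -ltNge.
  apply: measurableC; rewrite ray_bigcup1; apply: bigcupT_measurable => n.
  by apply: sub_sigma_algebra; exists x, n%:R.
have m2 : measurable_fun setT (snd : g_sigma_algebraType quadrants -> measurableTypeR R).
  apply: (measurability (@RGenOInfty.G R)); first exact: RGenOInfty.measurableE.
  move=> _ [_ [x ->] <-]; rewrite setTI.
  rewrite (_ : snd @^-1` _ = ~` [set p : R2 | p.2 <= x]); last first.
    apply/seteqP; split => p /=; rewrite in_itv/= andbT; first by rewrite ltNge => /negP.
    by move=> /negP; rewrite -ltNge.
  apply: measurableC; rewrite ray_bigcup2; apply: bigcupT_measurable => n.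
  by apply: sub_sigma_algebra; exists n%:R, x.
rewrite measurable_prod_measurableType; apply: smallest_sub.
  exact: smallest_sigma_algebra.
move=> _ [U mU [V mV <-]].
rewrite (_ : U `*` V = (fst @^-1` U) `&` (snd @^-1` V)); last first.
  by apply/seteqP; split => -[].
have := @measurableI _ (g_sigma_algebraType quadrants); apply.
  by rewrite -[X in measurable X]setTI; exact: m1.
by rewrite -[X in measurable X]setTI; exact: m2.
Qed.

Lemma measure_quadrant_unique (m1 m2 : {measure set R2 -> \bar R}) :
  (forall x y, m1 (quadrant x y) = m2 (quadrant x y)) ->
  (forall x y, (m1 (quadrant x y) < +oo)%E) ->
  forall S, measurable S -> m1 S = m2 S.
Proof.
move=> m12 m1oo S mS.
apply: (measure_unique quadrants (fun n => quadrant n%:R n%:R)) => //.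
- exact: measurable_quadrantsE.
- move=> _ _ [x [y ->]] [x' [y' ->]]; exists (Num.min x x'), (Num.min y y').
  by apply/seteqP; split => [[u v]|[u v]]; rewrite /quadrant /= !in_itv/= !le_min;
    [case=> -[? ?] [? ?]; split; apply/andP|move=> [/andP[? ?] /andP[? ?]]].
- by move=> n; exists n%:R, n%:R.
- apply/seteqP; split => // -[u v] _; exists (Num.bound (Num.max `|u| `|v|)) => //.
  have bd : Num.max `|u| `|v| < (Num.bound (Num.max `|u| `|v|))%:R.
    by apply: archi_boundP; rewrite le_max normr_ge0.
  by split; rewrite /= in_itv/= ltW//; apply: le_lt_trans bd; rewrite le_max ler_norm ?orbT.
- by move=> _ [x [y ->]].
Qed.

End quadrant_uniqueness.

(** * The fixed-point equation for measures, and Kendall's tau *)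

Section kendall.
Context {R : realType} (N : nat) (pi : 'S_N) (N_gt1 : (2 <= N)%N) (A : copula R).
Hypothesis hA : eq_on_square (joint_cdf (Vop pi (copula_measure A))) A.
Local Notation R2 := (measurableTypeR R * measurableTypeR R)%type.
Local Notation mu := (copula_measure A).

Let N_gt0 : 0 < N%:R :> R.
Proof. by rewrite ltr0n ltnW. Qed.

Lemma copula_clampl (B : copula R) (x y : R) : B (clamp x) y = B x y.
Proof.
have [x0|x0] := leP x 0; first by rewrite clamp_le0// !copula_le0l.
have [x1|x1] := leP 1 x; first by rewrite clamp_ge1// !copula_ge1l.
by rewrite clamp_id// !ltW.
Qed.

Lemma copula_clampr (B : copula R) (x y : R) : B x (clamp y) = B x y.
Proof.
have [x0|x0] := leP y 0; first by rewrite clamp_le0// !copula_le0r.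
have [x1|x1] := leP 1 y; first by rewrite clamp_ge1// !copula_ge1r.
by rewrite clamp_id// !ltW.
Qed.

Let clampN (j : 'I_N) (x : R) :
  clamp (N%:R * clamp x - j%:R) = clamp (N%:R * x - j%:R).
Proof.
have j0 : 0 <= j%:R :> R by [].
have jN : j%:R + 1 <= N%:R :> R by rewrite natr1 ler_nat.
have [x0|x0] := leP x 0.
  by rewrite (clamp_le0 x0) !clamp_le0//; nra.
have [x1|x1] := leP 1 x; last by rewrite (@clamp_id _ x)// !ltW.
by rewrite (clamp_ge1 x1) !clamp_ge1//; nra.
Qed.

Let I01_clamp (x : R) : I01 (clamp x).
Proof.
rewrite /I01 /= in_itv/= /clamp le_max lexx/= ge_max ler01 ge_min lexx.
by rewrite orbT.
Qed.

(** The equation is given on the square, while the uniqueness argument tests all quadrants; neither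
    side changes when the arguments are clamped. *)
Lemma joint_cdf_Vop_fixpoint (x y : R) : joint_cdf (Vop pi mu) x y = A x y.
Proof.
rewrite -copula_clampl -copula_clampr -hA ?I01_clamp//.
rewrite !(joint_cdf_Vop pi N_gt1); congr (_ * _); apply: eq_bigr => i _.
by rewrite -copula_clampl -copula_clampr -[RHS]copula_clampl -[RHS]copula_clampr !clampN.
Qed.

Lemma measurable_cell_map (j k : 'I_N) : measurable_fun setT
  (cell_map j k : R2 -> R2).
Proof.
rewrite (_ : cell_map j k = affine2 N%:R^-1 (j%:R / N%:R) (k%:R / N%:R)).
  exact: measurable_affine2.
by apply/funext => -[u v]; rewrite /cell_map /affine2 /=; congr pair; field; rewrite gt_eqF.
Qed.

Let Ni_ge0 : 0 <= N%:R^-1 :> R. Proof. by rewrite invr_ge0. Qed.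

Let push (i : 'I_N) : {measure set R2 -> \bar R} :=
  mscale (NngNum Ni_ge0)
    (measure_function_pushforward__canonical__measure_function_Measure mu
      (measurable_cell_map (pi i) i)).

Let pushE (i : 'I_N) S :
  push i S = ((N%:R^-1)%:E * mu (cell_map (pi i) i @^-1` S))%E.
Proof. by []. Qed.

(** [msum] adds up a sequence indexed by [nat], hence the extension by the zero measure. *)
Let push_nat (n : nat) : {measure set R2 -> \bar R} :=
  if insub n is Some i then push i else mzero.

Let total : {measure set R2 -> \bar R} := msum push_nat N.

Let totalE S : total S = (\sum_(i < N) push i S)%E.
Proof. by rewrite /total /msum /=; apply: eq_bigr => i _; rewrite /push_nat valK. Qed.

Lemma copula_measure_fixpoint S : measurable S -> mu S = total S.
Proof.
apply: measure_quadrant_unique => x y; last first.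
  by rewrite [X in (X < _)%E](copula_quadrantE A x y) ltry.
rewrite [LHS](copula_quadrantE A x y) totalE -joint_cdf_Vop_fixpoint (joint_cdf_Vop pi N_gt1).
rewrite mulr_sumr -sumEFin; apply: eq_bigr => i _.
rewrite pushE EFinM -copula_quadrantE; congr (_ * mu _)%E.
apply/seteqP; split => -[u v]; rewrite /quadrant /cell_map /= !in_itv/=;
  rewrite !ler_pdivrMr// => -[? ?]; split; lra.
Qed.

(** [A x y] is the mass of the section at [(x, y)] of the set [S] of pairs whose second point is
    below the first in both coordinates, and masses of sections depend measurably on the point. *)
Lemma measurable_copula : measurable_fun setT (fun p : R2 => A p.1 p.2).
Proof.
pose S : set (R2 * R2) := [set z | z.2.1 <= z.1.1] `&` [set z | z.2.2 <= z.1.2].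
have mle (f g : R2 * R2 -> measurableTypeR R) : measurable_fun setT f -> measurable_fun setT g ->
    measurable [set z | f z <= g z].
  move=> mf mg; rewrite (_ : [set z | _] = (fun z => g z - f z) @^-1` `[0, +oo[%classic).
    have mh : measurable_fun setT (fun z => g z - f z : measurableTypeR R).
      exact: measurable_funB.
    by rewrite -[X in measurable X]setTI; apply: mh; [|exact: measurable_itv].
  by apply/seteqP; split => z /=; rewrite in_itv/= andbT subr_ge0.
have mS : measurable S.
  apply: measurableI; apply: mle.
  - by apply: (measurableT_comp measurable_fst).
  - by apply: (measurableT_comp measurable_fst).
  - by apply: (measurableT_comp measurable_snd).
  - by apply: (measurableT_comp measurable_snd).
apply/measurable_EFinP; rewrite (_ : EFin \o _ = mu \o xsection S).
  exact: measurable_fun_xsection.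
apply/funext => -[x y] /=; rewrite -copula_quadrantE; congr (mu _).
by apply/seteqP; split => -[u v]; rewrite /xsection /quadrant /= !in_itv/= ?inE /S.
Qed.

Lemma integral_square (f : R2 -> \bar R) : (forall p, (0 <= f p)%E) ->
  (\int[mu]_(p in square) f p = \int[mu]_p f p)%E.
Proof.
move=> f0; have mq := @measurable_square R.
have C0 : mu (~` square) = 0%E.
  by rewrite probability_setC// copula_square subee.
rewrite integral_mkcond; apply/eqP; rewrite eq_le; apply/andP; split.
  apply: (ge0_le_integral_negl (measurableC mq) C0) => //.
    by move=> p _; exact: erestrict_ge0.
  by move=> p _ _; rewrite patchE; case: ifP.
apply: (ge0_le_integral_negl (measurableC mq) C0) => //.
  by move=> p _; exact: erestrict_ge0.
by move=> p _ /contrapT sp; rewrite patchE mem_set.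
Qed.

(** The number of non-inversions of [pi]: pairs [k < i] with [pi k < pi i]. *)
Definition concordant : R := \sum_(i < N) (cell_base pi (pi i) i)%:R.

(** For [j = pi i] a dominated cell [(j, k)] is an inversion [i < k], [pi k < pi i]; inversions and
    non-inversions together number [N * (N - 1) / 2]. *)
Lemma sum_concordant :
  2 * concordant + 2 * #|dominated_pairs pi|%:R = N%:R * (N%:R - 1) :> R.
Proof.
pose lt2 (i k : 'I_N) : R := (pi k < pi i)%N%:R.
pose S := \sum_i \sum_k lt2 i k.
have S2 : S + S + N%:R = N%:R * N%:R.
  rewrite {2}/S exchange_big/= /S -big_split/=.
  rewrite -[in LHS](_ : \sum_(i < N) \sum_(k < N) (pi k == pi i)%:R = N%:R :> R); last first.
    rewrite (eq_bigr (fun=> 1)) ?sumr_const ?card_ord// => i _.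
    rewrite (bigD1 i)//= eqxx big1 ?addr0// => k ki.
    by rewrite (inj_eq perm_inj) (negbTE ki).
  rewrite -big_split/= (eq_bigr (fun=> N%:R)).
    by rewrite sumr_const card_ord -[_ *+ _]mulr_natl.
  move=> i _; rewrite -!big_split/= (eq_bigr (fun=> 1)) ?sumr_const ?card_ord// => k _.
  rewrite /lt2 -(inj_eq val_inj).
  by case: (ltngtP (pi k) (pi i)) => _ /=; ring.
have SE : S = concordant + #|dominated_pairs pi|%:R.
  rewrite sum_dominated -(pair_bigA _ (fun j k => (slope1 pi j k && slope2 pi j k)%:R)) /=.
  rewrite [X in _ + X](reindex_inj (@perm_inj _ pi))/= /concordant -big_split/=.
  apply: eq_bigr => i _; rewrite /cell_base natr_sum -big_split/=.
  apply: eq_bigr => k _; rewrite /lt2 /slope1 /slope2 permK.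
  case: (ltngtP i k) => [|| /val_inj ->]; rewrite ?andbF ?andbT ?add0r ?addr0//=.
  by rewrite ltnn.
by rewrite mulrBr mulr1 -S2 SE; ring.
Qed.

Lemma kendall_tau_fixpoint : kendall_tau A =
  (1 - 4 * (1 / (N%:R * (N%:R - 1))) * #|dominated_pairs pi|%:R)%:E.
Proof.
have mA := measurable_copula.
have mAE : measurable_fun setT (fun p : R2 => (A p.1 p.2)%:E) by exact/measurable_EFinP.
have A0 (p : R2) : (0 <= (A p.1 p.2)%:E)%E by rewrite lee_fin copula_ge0.
rewrite /kendall_tau; set I := integral _ _ _.
have mq := @measurable_square R.
(* In the extended reals +oo also solves the equation [IE] below; the bound on [A] rules it out. *)
have I1 : (I <= 1)%E.
  apply: (@le_trans _ _ (\int[mu]_(p in square) (cst 1 p))%E).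
    apply: ge0_le_integral => //; first exact: measurable_funTS.
    by move=> p _; rewrite lee_fin copula_le1.
  by rewrite integral_cst// [X in (_ * X <= _)%E](copula_square A) mule1.
have I0 : (0 <= I)%E by apply: integral_ge0.
have [r rE] : exists r, I = r%:E.
  by exists (fine I); rewrite fineK// ge0_fin_numE// (le_lt_trans I1)// ltry.
have IE : (I = (N%:R ^- 2 * concordant)%:E + (N%:R^-1)%:E * I)%E.
  rewrite {1}/I integral_square//.
  rewrite (eq_measure_integral total); last by move=> S mS _; exact: copula_measure_fixpoint.
  rewrite /total ge0_integral_measure_sum//.
  transitivity (\sum_(i < N) ((N%:R^-1)%:E *
     ((N%:R^-1 * (cell_base pi (pi i) i)%:R)%:E + (N%:R^-1)%:E * I)))%E.
    apply: eq_bigr => i _; rewrite /push_nat valK.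
    rewrite /push ge0_integral_mscale//=; congr (_ * _)%E.
    rewrite (ge0_integral_pushforward (measurable_cell_map (pi i) i))//.
    rewrite preimage_setT -integral_square; last by move=> p; exact: A0.
    transitivity (\int[mu]_(p in square) ((N%:R^-1 * (cell_base pi (pi i) i)%:R)%:E
       + (N%:R^-1)%:E * (A p.1 p.2)%:E))%E.
      apply: eq_integral => -[u v]; rewrite inE => -[]; rewrite /I01 /= !in_itv/= => uI vI.
      rewrite -EFinM -EFinD; congr EFin; rewrite (copula_cell N_gt1 hA)//.
      by rewrite !(slope_diag (erefl (pi i))) eqxx /=; ring.
    rewrite ge0_integralD//; last 2 first.
    - by move=> p _; rewrite mule_ge0.
    - by apply: measurable_funTS; apply: emeasurable_funM.
    rewrite integral_cst// [X in (_ * X + _)%E](copula_square A) mule1 ge0_integralZl//.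
    exact: measurable_funTS.
  rewrite rE -EFinM -EFinD; under eq_bigr do rewrite -EFinD -EFinM.
  rewrite sumEFin; congr EFin; rewrite -mulr_sumr big_split/= -mulr_sumr sumr_const card_ord.
  by rewrite -[_ *+ N]mulr_natl -/concordant; field; rewrite gt_eqF.
have N2 : 2 <= N%:R :> R by rewrite ler_nat.
have N0 : N%:R != 0 :> R by rewrite gt_eqF.
have N10 : N%:R - 1 != 0 :> R by apply: lt0r_neq0; lra.
have {IE}rE' : r = concordant / (N%:R * (N%:R - 1)).
  move: IE; rewrite rE -EFinM -EFinD => -[]rr.
  have : r * (1 - N%:R^-1) = N%:R ^- 2 * concordant by rewrite mulrBr mulr1 {1}rr; ring.
  move=> h; apply: (mulIf (_ : 1 - N%:R^-1 != 0)).
    by apply: lt0r_neq0; rewrite subr_gt0 invf_lt1; lra.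
  by rewrite h; field; rewrite N10 N0.
rewrite rE -EFinM -EFinB rE'; congr EFin.
have cE : concordant = (N%:R * (N%:R - 1) - 2 * #|dominated_pairs pi|%:R) / 2.
  by rewrite -sum_concordant; field.
by rewrite cE; field; rewrite N10 N0.
Qed.

End kendall.

(** * The set Omega *)

Section negligible_tools.
Context {R : realType}.

Lemma negligible_countable_bigcup d (T : measurableType d)
    (mu : {measure set T -> \bar R}) (I : countType) (F : I -> set T) :
  (forall i, mu.-negligible (F i)) -> mu.-negligible (\bigcup_i F i).
Proof.
move=> F0; pose G n := if unpickle n is Some i then F i else set0.
apply: (@negligibleS _ _ _ mu (\bigcup_n G n)).
  by move=> x [i _ Fx]; exists (pickle i) => //; rewrite /G pickleK.
apply: negligible_bigcup => n; rewrite /G.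
by case: unpickle => [i|]; [exact: F0|exact: negligible_set0].
Qed.

(* [lebesgue_measure] takes the value of the outer measure on nonmeasurable
   sets. *)
Lemma le_lebesgue_measure (A B : set R) : A `<=` B ->
  (@lebesgue_measure R A <= @lebesgue_measure R B)%E.
Proof.
move=> AB; rewrite /lebesgue_measure /lebesgue_stieltjes_measure /measure_extension /=.
exact: le_outer_measure.
Qed.

(** [W] may fail to be measurable; it is squeezed between the measurable sets [E] minus [Z] and [E]
    union [Z]. *)
Lemma lebesgue_measure_mod_null (W E Z : set (measurableTypeR R)) :
  measurable E -> measurable Z -> @lebesgue_measure R Z = 0%E ->
  (forall y, ~ Z y -> W y <-> E y) ->
  @lebesgue_measure R W = @lebesgue_measure R E.
Proof.
move=> mE mZ Z0 WE; apply/eqP; rewrite eq_le; apply/andP; split.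
  apply: (@le_trans _ _ (lebesgue_measure (E `|` Z))).
    apply: le_lebesgue_measure => y Wy.
    by have [Zy|Zy] := pselect (Z y); [right|left; apply/(WE y)].
  by apply: le_trans (measureU2 _ _ _) _ => //; rewrite [X in (_ + X)%E]Z0 adde0.
apply: (@le_trans _ _ (lebesgue_measure (E `\` Z))).
  have -> : lebesgue_measure E = lebesgue_measure (E `\` Z).
    have EZ0 : lebesgue_measure (E `&` Z) = 0%E.
      by apply: (subset_measure0 _ mZ _ Z0) => [|y []//]; exact: measurableI.
    by rewrite [LHS](measureDI _ mE mZ) [X in (_ + X)%E]EZ0 adde0.
  exact: lexx.
by apply: le_lebesgue_measure => y [Ey Zy]; apply/(WE y).
Qed.

Lemma lebesgue_measure_null_setU (A B : set (measurableTypeR R)) :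
  measurable A -> measurable B -> @lebesgue_measure R A = 0%E ->
  @lebesgue_measure R B = 0%E -> @lebesgue_measure R (A `|` B) = 0%E.
Proof.
move=> mA mB A0 B0; apply/eqP; rewrite eq_le measure_ge0 andbT.
apply: le_trans (measureU2 _ _ _) _ => //.
by rewrite [X in (X + _)%E]A0 [X in (_ + X)%E]B0 adde0.
Qed.

End negligible_tools.

(** * The shuffle V_pi(M) and its set Omega *)

Section shuffle_of_M.
Context {R : realType} (N : nat) (pi : 'S_N) (N_gt1 : (2 <= N)%N).
Variables (M : copula R) (h : R -> R).
Hypothesis hM : eq_on_square M (fun x y => Num.min x y).
Hypothesis h_mpb : measure_preserving_bij h.
Hypothesis h_VM : eq_on_square (mcd_fun h) (joint_cdf (Vop pi (copula_measure M))).
Local Notation lambda := (@lebesgue_measure R).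
Local Notation R1 := (measurableTypeR R).
Local Notation R2 := (measurableTypeR R * measurableTypeR R)%type.
Implicit Types (i j k : 'I_N) (t u v x y : R).

Let N_gt0 : 0 < N%:R :> R.
Proof. by rewrite ltr0n ltnW. Qed.

Let Ni_gt0 : 0 < N%:R^-1 :> R.
Proof. by rewrite invr_gt0. Qed.

Let ler_ordS j : j%:R + 1 <= N%:R :> R.
Proof. by rewrite natr1 ler_nat. Qed.

Let I01P x : I01 x <-> 0 <= x <= 1.
Proof. by rewrite /I01 /= in_itv. Qed.

Let cell_I01 j u : 0 <= u <= 1 -> I01 ((j%:R + u) / N%:R).
Proof.
move=> /andP[u0 u1]; apply/I01P; rewrite divr_ge0 ?addr_ge0// ler_pdivrMr// mul1r.
by have := ler_ordS j; lra.
Qed.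

Let sub_cdf x y : set R1 := [set t | 0 <= t <= x /\ h t <= y].

Let measurable_sub_cdf x y : x <= 1 -> measurable (sub_cdf x y).
Proof.
move=> x1; have [_ mh _] := h_mpb.
rewrite (_ : sub_cdf x y = `[0, x]%classic `&` (I01 `&` h @^-1` `]-oo, y]%classic)).
  apply: measurableI; first exact: measurable_itv.
  by apply: mh; [exact: measurable_I01|exact: measurable_itv].
apply/seteqP; split => t; rewrite /sub_cdf /I01 /= !in_itv/=.
  by move=> [/andP[-> tx] ->]; rewrite tx (le_trans tx x1).
by case=> -> [_ ->].
Qed.

Let lambda_sub_cdf j u v : 0 <= u <= 1 -> 0 <= v <= 1 ->
  lambda (sub_cdf ((j%:R + u) / N%:R) ((((pi^-1)%g j)%:R + v) / N%:R)) =
  (N%:R^-1 * ((cell_base pi j ((pi^-1)%g j))%:R + Num.min u v))%:E.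
Proof.
move=> uI vI; set x := _ / _; set y := _ / _.
have xI : I01 x by exact: cell_I01.
have yI : I01 y by exact: cell_I01.
have x1 : x <= 1 by move/I01P: xI => /andP[].
have -> : lambda (sub_cdf x y) = (mcd_fun h x y)%:E.
  rewrite /mcd_fun fineK// ge0_fin_numE ?measure_ge0//.
  apply: (@le_lt_trans _ _ (leb (I01 : set R))); last by rewrite leb_I01 ltry.
  apply: le_lebesgue_measure => t [/andP[t0 tx] _].
  by apply/I01P; rewrite t0 (le_trans tx x1).
rewrite h_VM// joint_cdf_Vop_cell//.
have pj : pi ((pi^-1)%g j) = j by rewrite permKV.
rewrite !(slope_diag pj) pj eqxx /= hM ?mul1r ?mul0r ?addr0//; exact/I01P.
Qed.

(** From [a] to [b] the measure of the points with [h t <= y] grows by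
    [(min v v - min 0 v) / N = v / N], the full length of the interval, so almost all its points
    satisfy the inequality. *)
Let bad_low j v : 0 < v < 1 -> lambda.-negligible
  [set t | j%:R / N%:R < t <= (j%:R + v) / N%:R /\ (((pi^-1)%g j)%:R + v) / N%:R < h t].
Proof.
move=> /andP[/ltW v0 /ltW v1]; set y := (((pi^-1)%g j)%:R + v) / N%:R.
have vI : 0 <= v <= 1 by rewrite v0.
set b := (j%:R + v) / N%:R; set a := j%:R / N%:R.
have aE : a = (j%:R + 0) / N%:R by rewrite addr0.
have b1 : b <= 1 by have /I01P/andP[] := cell_I01 j vI.
have ab : a <= b by rewrite ler_pM2r// lerDl.
have a0 : 0 <= a by rewrite divr_ge0.
have mb := measurable_sub_cdf y b1; have ma := measurable_sub_cdf y (le_trans ab b1).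
have lb := lambda_sub_cdf j vI vI; rewrite -/b -/y in lb.
have la : lambda (sub_cdf a y) = (N%:R^-1 * (cell_base pi j ((pi^-1)%g j))%:R)%:E.
  by rewrite aE lambda_sub_cdf ?lexx ?ler01// min_l// addr0.
have mD : measurable (sub_cdf b y `\` sub_cdf a y) by exact: measurableD.
have lD : lambda (sub_cdf b y `\` sub_cdf a y) = (N%:R^-1 * v)%:E.
  rewrite measureD//=; last by rewrite lb ltry.
  rewrite setIidr; last first.
    by move=> t [/andP[t0 ta] hty]; split => //; rewrite t0 (le_trans ta ab).
  by rewrite lb la minxx -EFinB; congr EFin; ring.
exists (`]a, b]%classic `\` (sub_cdf b y `\` sub_cdf a y)); split.
- by apply: measurableD => //; exact: measurable_itv.
- have lab : lambda `]a, b]%classic = (N%:R^-1 * v)%:E.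
    rewrite lebesgue_measure_itv/= lte_fin; case: ltgtP ab => // [_ _|abE _].
      by rewrite -EFinB /a /b; congr EFin; ring.
    have /eqP := abE; rewrite /a /b (inj_eq (mulIf (lt0r_neq0 Ni_gt0))) -subr_eq0 opprD addNKr.
    by rewrite oppr_eq0 => /eqP ->; rewrite mulr0.
  rewrite measureD//=; last by rewrite lab ltry.
  rewrite setIidr; first by rewrite lab lD -EFinB subrr.
  move=> t [[/andP[t0 tb] hty] nta]; rewrite /= in_itv/= tb andbT ltNge; apply/negP => ta.
  by apply: nta; rewrite /sub_cdf /= t0 ta.
- move=> t [tab hty]; split; first by rewrite /= in_itv.
  by move=> [[_ hty']]; move: hty; rewrite ltNge hty'.
Qed.

(** Here the growth is [(min 1 v - min v v) / N = 0]. *)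
Let bad_high j v : 0 < v < 1 -> lambda.-negligible
  [set t | (j%:R + v) / N%:R < t <= (j%:R + 1) / N%:R /\ h t <= (((pi^-1)%g j)%:R + v) / N%:R].
Proof.
move=> /andP[/ltW v0 /ltW v1]; set y := (((pi^-1)%g j)%:R + v) / N%:R.
have vI : 0 <= v <= 1 by rewrite v0.
have oneI : 0 <= (1 : R) <= 1 by rewrite ler01 lexx.
set b := (j%:R + 1) / N%:R; set a := (j%:R + v) / N%:R.
have b1 : b <= 1 by have /I01P/andP[] := cell_I01 j oneI.
have ab : a <= b by rewrite ler_pM2r// lerD2l.
have a0 : 0 <= a by rewrite divr_ge0// addr_ge0.
have mb := measurable_sub_cdf y b1; have ma := measurable_sub_cdf y (le_trans ab b1).
have lb := lambda_sub_cdf j oneI vI; rewrite -/b -/y in lb.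
have la := lambda_sub_cdf j vI vI; rewrite -/a -/y in la.
exists (sub_cdf b y `\` sub_cdf a y); split.
- exact: measurableD.
- rewrite measureD//=; last by rewrite lb ltry.
  rewrite setIidr; last first.
    by move=> t [/andP[t0 ta] hty]; split => //; rewrite t0 (le_trans ta ab).
  by rewrite lb la minxx min_r// -EFinB subrr.
- move=> t [/andP[ta tb] hty]; split.
    by split => //; rewrite tb andbT (le_trans a0)// ltW.
  by move=> [/andP[_ ta'] _]; move: ta; rewrite ltNge ta'.
Qed.

(** The null sets of [bad_low] and [bad_high] for rational heights are countably many; off their
    union, rationals on both sides of [u] force the value of [h]. *)
Lemma shuffle_ae : exists B : set R1, [/\ measurable B, lambda B = 0%E &
  forall j u, 0 < u < 1 -> ~ B ((j%:R + u) / N%:R) ->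
    h ((j%:R + u) / N%:R) = (((pi^-1)%g j)%:R + u) / N%:R].
Proof.
pose low (c : 'I_N * rat) := [set t | 0 < (ratr c.2 : R) < 1 /\
  (c.1%:R / N%:R < t <= (c.1%:R + ratr c.2) / N%:R /\
  (((pi^-1)%g c.1)%:R + ratr c.2) / N%:R < h t)].
pose high (c : 'I_N * rat) := [set t | 0 < (ratr c.2 : R) < 1 /\
  ((c.1%:R + ratr c.2) / N%:R < t <= (c.1%:R + 1) / N%:R /\
  h t <= (((pi^-1)%g c.1)%:R + ratr c.2) / N%:R)].
have [B [mB B0 BE]] : lambda.-negligible ((\bigcup_c low c) `|` (\bigcup_c high c)).
  apply: negligibleU; apply: negligible_countable_bigcup => -[j q].
    have [qI|qI] := boolP (0 < (ratr q : R) < 1).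
      by apply: negligibleS (bad_low j qI) => t [].
    by apply: negligibleS (negligible_set0 _) => t []; rewrite (negbTE qI).
  have [qI|qI] := boolP (0 < (ratr q : R) < 1).
    by apply: negligibleS (bad_high j qI) => t [].
  by apply: negligibleS (negligible_set0 _) => t []; rewrite (negbTE qI).
exists B; split => // j u /andP[u0 u1] nB; set t := (j%:R + u) / N%:R in nB *.
have lowq (q : rat) : 0 < (ratr q : R) < 1 -> u <= ratr q ->
    h t <= (((pi^-1)%g j)%:R + ratr q) / N%:R.
  move=> qI uq; rewrite leNgt; apply/negP => ht; apply: nB; apply: BE; left.
  exists (j, q) => //; split => //; split => //=.
  by rewrite /t ltr_pM2r// ler_pM2r// lerD2l uq andbT ltrDl.
have highq (q : rat) : 0 < (ratr q : R) < 1 -> ratr q < u ->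
    (((pi^-1)%g j)%:R + ratr q) / N%:R < h t.
  move=> qI uq; rewrite ltNge; apply/negP => ht; apply: nB; apply: BE; right.
  exists (j, q) => //; split => //; split => //=.
  by rewrite /t ltr_pM2r// ler_pM2r// !lerD2l ltrD2l uq ltW.
pose w := N%:R * h t - ((pi^-1)%g j)%:R.
have hE : h t = (((pi^-1)%g j)%:R + w) / N%:R.
  by rewrite /w subrKC mulrC mulKf// gt_eqF.
rewrite hE; congr (_ / _); congr (_ + _).
have [wu|uw|//] := ltgtP w u.
  have m0 : Num.max w 0 < u by rewrite gt_max wu.
  have [q] := rat_in_itvoo m0; rewrite in_itv/= gt_max => /andP[/andP[wq q0] qu].
  have /(_ _ qu) := highq q; rewrite q0 (lt_trans qu u1) => /(_ isT).
  by rewrite hE ltr_pM2r// ltrD2l ltNge ltW.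
have m0 : u < Num.min w 1 by rewrite lt_min uw.
have [q] := rat_in_itvoo m0; rewrite in_itv/= lt_min => /andP[uq /andP[qw q1]].
have /(_ _ (ltW uq)) := lowq q; rewrite q1 (lt_trans u0 uq) => /(_ isT).
by rewrite hE ler_pM2r// lerD2l leNgt qw.
Qed.

Definition dominated_cells : set R2 :=
  \bigcup_(c in [set c : 'I_N * 'I_N | slope1 pi c.1 c.2 && slope2 pi c.1 c.2])
    (cell_inv c @^-1` open_square).

Let measurable_cell_preimage (c : 'I_N * 'I_N) : measurable (cell_inv c @^-1` open_square : set R2).
Proof.
rewrite -[X in measurable X]setTI; apply: measurable_affine2 => //.
exact: measurable_open_square.
Qed.

Lemma measurable_dominated_cells : measurable dominated_cells.
Proof. by apply: fin_bigcup_measurable => // c _; exact: measurable_cell_preimage. Qed.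

Lemma leb2_dominated_cells :
  leb2 dominated_cells = (#|dominated_pairs pi|%:R / N%:R ^+ 2)%:E.
Proof.
have mo := @measurable_open_square R.
have mD := measurable_dominated_cells.
have o0 (p : R2) : 0 <= \1_(open_square : set R2) p :> R by rewrite indicE.
have mi : measurable_fun setT (EFin \o (\1_(open_square : set R2) : R2 -> R)).
  by apply/measurable_EFinP; exact: measurable_indic.
transitivity (\int[leb2]_p (\1_dominated_cells p)%:E)%E.
  by rewrite integral_indic// setIT.
transitivity (\int[leb2]_p (\sum_(c : 'I_N * 'I_N)
    ((slope1 pi c.1 c.2 && slope2 pi c.1 c.2)%:R)%:E * (\1_(open_square : set R2) (cell_inv c p))%:E))%E.
  apply: eq_integral => p _; under eq_bigr do rewrite -EFinM.
  rewrite sumEFin; congr EFin; rewrite indicE.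
  have [|np] := boolP (p \in dominated_cells).
    rewrite inE => -[c /= dc oc]; rewrite (bigD1 c)//= dc indicE mem_set// mulr1.
    rewrite big1 ?addr0// => c' c'c; rewrite indicE memNset ?mulr0// => oc'.
    by move: c'c; rewrite (cell_inv_uniq oc' oc) eqxx.
  rewrite big1// => c _; have [dc|] := boolP (slope1 pi c.1 c.2 && _); last by rewrite mul0r.
  rewrite indicE memNset ?mulr0// => oc.
  by move: np; rewrite notin_setE; apply; exists c.
rewrite ge0_integral_sum//; last first.
  move=> c; apply/measurable_EFinP; apply: measurable_funM => //.
  by apply: (measurableT_comp (measurable_indic mo)); exact: measurable_affine2.
rewrite sum_dominated mulr_suml -sumEFin; apply: eq_bigr => c _.
rewrite ge0_integralZl//; last first.
  apply/measurable_EFinP.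
  by apply: (measurableT_comp (measurable_indic mo)); exact: measurable_affine2.
rewrite EFinM; congr (_ * _)%E.
rewrite (@ge0_integral_affine2 _ _ _ _ (EFin \o (\1_(open_square : set R2) : R2 -> R)))//.
have -> : (\int[leb2]_p (EFin \o (\1_(open_square : set R2) : R2 -> R)) p = 1)%E.
  by rewrite integral_indic// setIT; exact: leb2_open_square.
by rewrite mule1.
Qed.

Lemma leb2_Omega : leb2 (Omega_sqrt2 h) = (#|dominated_pairs pi|%:R / N%:R ^+ 2)%:E.
Proof.
rewrite -leb2_dominated_cells.
have [B [mB B0 hB]] := shuffle_ae.
have [[_ hinj _] _ _] := h_mpb.
(* [shift i] carries row [i] to column [pi i], inverting the piecewise translation; [C] contains the
   ordinates whose abscissa falls into [B]. The factor 1 fits the form of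
   [lebesgue_measure_affine]. *)
pose shift i y : R1 := 1 * y + ((pi i)%:R - i%:R) / N%:R.
have [C [mC C0 CE]] : lambda.-negligible (\bigcup_i (shift i @^-1` B)).
  apply: negligible_countable_bigcup => i; exists (shift i @^-1` B); split => //.
    by rewrite -[X in measurable X]setTI; exact: measurable_affine.
  have := @lebesgue_measure_affine R 1 (((pi i)%:R - i%:R) / N%:R) B ltr01 mB.
  by rewrite /pushforward invr1 mul1e B0.
have hinv i v : 0 < v < 1 -> ~ C ((i%:R + v) / N%:R) ->
    'pinv_(fun=> 0) I01 h ((i%:R + v) / N%:R) = ((pi i)%:R + v) / N%:R.
  move=> vI nC; set x := ((pi i)%:R + v) / N%:R.
  have hx : h x = (i%:R + v) / N%:R.
    rewrite /x hB// ?permK// => Bx; apply: nC; apply: CE; exists i => //.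
    rewrite /shift /=; move: Bx; rewrite /x; congr B.
    by field; rewrite gt_eqF.
  rewrite -hx pinvKV//.
  by rewrite inE; apply: cell_I01; move: vI => /andP[/ltW -> /ltW ->].
have mN := @measurable_Nadic R N N_gt1.
have lN := @lebesgue_measure_Nadic R N N_gt1.
have lt_cell (a b : nat) (u v : R) : (a < b)%N -> 0 < u < 1 -> 0 < v < 1 ->
    (a%:R + u) / N%:R < (b%:R + v) / N%:R.
  move=> ab /andP[? ?] /andP[? ?]; rewrite ltr_pM2r//.
  have {ab} : a.+1%:R <= b%:R :> R by rewrite ler_nat.
  by rewrite -natr1; lra.
(* In a cell over the graph of [pi] the two conditions of Omega read [u <= v] and [v <= u], so they
   leave only the graph of [h], one point in each vertical section. *)
have Omega_iff x y : ~ B x -> ~ Nadic N x -> ~ C y -> ~ Nadic N y -> y != h x ->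
    Omega_sqrt2 h (x, y) <-> dominated_cells (x, y).
  move=> nBx nNx nCy nNy yhx; split.
    move=> [/open_squareE/= [/andP[x0 x1] /andP[y0 y1]] hxy hyx].
    have [j [u [uI xE _]]] := exists_open_cell_coord N_gt1 x0 x1 nNx.
    have [i [v [vI yE _]]] := exists_open_cell_coord N_gt1 y0 y1 nNy.
    exists (j, i); last first.
      rewrite /= (_ : (x, y) = cell_map (j, i).1 (j, i).2 (u, v)).
        by rewrite (cell_mapK N_gt1); split; rewrite /= in_itv.
      by rewrite /cell_map xE yE.
    rewrite xE yE in nBx nCy hxy hyx yhx; rewrite hB// in hxy yhx; rewrite hinv// in hyx.
    have s1 : slope1 pi j i.
      rewrite /slope1; case: ltngtP => // [ki|/val_inj ki].
        by have := lt_cell _ _ _ _ ki vI uI; rewrite ltNge hxy.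
      have pij : pi i = j by rewrite -ki permKV.
      move: hxy hyx yhx; rewrite ki pij !ler_pM2r// !lerD2l => uv vu.
      by rewrite (@le_anti _ _ u v) ?eqxx// uv vu.
    rewrite /= s1 /slope2 /=; case: ltngtP => // [ji|/val_inj pij].
      by have := lt_cell _ _ _ _ ji uI vI; rewrite ltNge hyx.
    by move: s1; rewrite /slope1 -pij permK ltnn.
  move=> [[j i] /= /andP[s1 s2] oc].
  have xyE := cell_invK N_gt1 (j, i) (x, y); move: oc xyE.
  case: (cell_inv _ _) => u v ouv [/= xE yE].
  have [uI vI] := open_squareE ouv; rewrite /= in uI vI.
  rewrite -xE -yE in nBx nCy *; split.
  - exact: (open_square_cell N_gt1 (j, i) ouv).
  - by rewrite /= hB// ltW// lt_cell.
  - by rewrite /= hinv// ltW// lt_cell.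
have xsE x : ~ (B `|` [set t | Nadic N t]) x ->
    lambda (xsection (Omega_sqrt2 h) x) = lambda (xsection dominated_cells x).
  move=> nx; apply: (@lebesgue_measure_mod_null _ _ _ (C `|` ([set t | Nadic N t] `|` [set h x]))).
  - exact: measurable_xsection measurable_dominated_cells.
  - apply: measurableU => //; apply: measurableU => //; exact: measurable_set1.
  - apply: lebesgue_measure_null_setU => //; first by apply: measurableU.
    apply: lebesgue_measure_null_setU => //; exact: lebesgue_measure_set1.
  move=> y ny; rewrite /xsection /= !inE; apply: Omega_iff.
  - by move=> h1; apply: nx; left.
  - by move=> h1; apply: nx; right.
  - by move=> h1; apply: ny; left.
  - by move=> h1; apply: ny; right; left.
  - by apply/eqP => h1; apply: ny; right; right.
have mZ : measurable (B `|` [set t | Nadic N t] : set R1) by exact: measurableU.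
have lZ : lambda (B `|` [set t | Nadic N t]) = 0%E by exact: lebesgue_measure_null_setU.
(* By definition the product measure of any set, measurable or not, is the integral of the measures
   of its sections, so comparing sections suffices. *)
rewrite (_ : leb2 _ = \int[lambda]_x lambda (xsection (Omega_sqrt2 h) x))%E//.
rewrite (_ : leb2 dominated_cells = \int[lambda]_x lambda (xsection dominated_cells x))%E//.
apply/eqP; rewrite eq_le; apply/andP; split.
  by apply: (ge0_le_integral_negl mZ lZ) => // x _ /xsE ->.
by apply: (ge0_le_integral_negl mZ lZ) => // x _ /xsE ->.
Qed.

End shuffle_of_M.

Theorem theorem4p3 (R : realType) (N : nat) (pi : 'S_N) (A M : copula R)
    (hN : (2 <= N)%N)
    (hA : eq_on_square (joint_cdf (Vop pi (copula_measure A))) A)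
    (hM : eq_on_square M (fun x y => Num.min x y)) :
  (forall h : R -> R, measure_preserving_bij h ->
     eq_on_square (mcd_fun h) (joint_cdf (Vop pi (copula_measure M))) ->
     [/\ kendall_tau A =
           (1 - (4 * (N%:R / (N%:R - 1)))%:E * leb2 (Omega_sqrt2 h))%E,
         length_measure A =
           (1 - ((2 - Num.sqrt 2) * (N%:R / (N%:R - 1)))%:E
                * leb2 (Omega_sqrt2 h))%E
       & surf A =
           ((Num.sqrt 2)%:E
            - ((2 * Num.sqrt 2 - 1 - Num.sqrt 3) * (N%:R / (N%:R - 1)))%:E
              * leb2 (Omega_sqrt2 h))%E]) /\
  kendall_tau A =
    (1 - 4 * (1 / (N%:R * (N%:R - 1))) * #|dominated_pairs pi|%:R)%:E /\
  length_measure A =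
    (1 - (2 - Num.sqrt 2) * (1 / (N%:R * (N%:R - 1)))
         * #|dominated_pairs pi|%:R)%:E.
Proof.
have tauE := kendall_tau_fixpoint hN hA.
have lenE := length_measure_fixpoint hN hA.
split; last by split.
move=> h h_mpb h_VM; rewrite tauE lenE (surf_fixpoint hN hA).
rewrite (leb2_Omega hN hM h_mpb h_VM).
have N2 : 2 <= N%:R :> R by rewrite ler_nat.
have N0 : N%:R != 0 :> R by apply: lt0r_neq0; lra.
have N10 : N%:R - 1 != 0 :> R by apply: lt0r_neq0; lra.
by split; rewrite -EFinM -EFinB; congr EFin; field; rewrite N10 N0.
Qed.
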